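(* Let $n\ge 1$, let $l>1$ and let $q\in\mathbb{C}^*$ be a primitive $l$-th root of unity. Then the center of $A^q_{n,\mathrm{f}_q}$ is isomorphic to $Z^q_{n,\mathrm{f}^l_q}$, and $A^q_{n,\mathrm{f}_q}$ is an Azumaya algebra (over its center).
   Context: For $q\in\mathbb{C}^*$ and $n\ge 1$, $A^q_n$ is the $\mathbb{C}$-algebra generated by $x_1,\dots,x_n,\partial_1,\dots,\partial_n$ with relations $\partial_i x_j-q^{\delta_{ij}}x_j\partial_i=\delta_{ij}$, $x_ix_j=x_jx_i$, $\partial_i\partial_j=\partial_j\partial_i$ for $1\le i,j\le n$. When $q$ is a primitive $l$-th root of unity with $l>1$, its center is the polynomial ring $Z^q_n=\mathbb{C}[x_1^l,\dots,x_n^l,\partial_1^l,\dots,\partial_n^l]$, and $A^q_n$ is free of rank $l^{2n}$ over $Z^q_n$. Put $\mathrm{f}_q=\prod_{i=1}^n(\partial_ix_i-x_i\partial_i)\in A^q_n$. The set $\{\mathrm{f}_q^k:k\ge 0\}$ is an Ore set and $A^q_{n,\mathrm{f}_q}$ is the Ore localization of $A^q_n$ obtained by inverting $\mathrm{f}_q$. One has $\mathrm{f}_q^l\in Z^q_n$, and $Z^q_{n,\mathrm{f}_q^l}$ denotes the localization of the commutative ring $Z^q_n$ obtained by inverting $\mathrm{f}_q^l$. An algebra $A$ that is free of rank $N^2$ over its center $Z$, with $Z$ a finitely generated $\mathbb{C}$-algebra, is called Azumaya if $A/(\mathfrak m)\cong M_N(\mathbb{C})$ for every maximal ideal $\mathfrak{m}$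 of $Z$. *)

(* Defs.v *)
From HB Require Import structures.
From mathcomp Require Import all_boot all_order all_algebra.
From mathcomp Require Import boolp classical_sets reals.
From mathcomp.multinomials Require Import monalg.
From mathcomp Require Import complex.

Set Implicit Arguments.
Unset Strict Implicit.
Unset Printing Implicit Defensive.

Import GRing.Theory.
Local Open Scope classical_set_scope.
Local Open Scope ring_scope.

(* Unital associative K-algebras, given as rings with a ring morphism from K
   to their center.  MathComp's algType excludes the zero ring, so it can carry
   neither quotients by arbitrary two-sided ideals nor 'M[K]_N for variable N. *)
HB.mixin Record isPzAlg (K : comNzRingType) A of GRing.PzRing A := {
  alg_const : K -> A;
  alg_const_zmod_morphism : zmod_morphism alg_const;
  alg_const_monoid_morphism : GRing.monoid_morphism alg_const;
  alg_constC : forall (c : K) (u : A), alg_const c * u = u * alg_const c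
}.

#[short(type="pzAlgType")]
HB.structure Definition PzAlg (K : comNzRingType) :=
  {A of GRing.PzRing A & isPzAlg K A}.

HB.instance Definition _ (K : comNzRingType) (A : pzAlgType K) :=
  GRing.isZmodMorphism.Build K A alg_const alg_const_zmod_morphism.
HB.instance Definition _ (K : comNzRingType) (A : pzAlgType K) :=
  GRing.isMonoidMorphism.Build K A alg_const alg_const_monoid_morphism.

Fact scalar_mx_central (K : comNzRingType) (N : nat) (c : K) (u : 'M[K]_N) :
  c%:M * u = u * c%:M.
Proof. by rewrite -[LHS]/(c%:M *m u) -scalar_mxC. Qed.
HB.instance Definition _ (K : comNzRingType) (N : nat) :=
  isPzAlg.Build K 'M[K]_N (raddfB (@scalar_mx K N))
    (scalar_mx_is_monoid_morphism K N) (@scalar_mx_central K N).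

Definition alg_hom (K : comNzRingType) (A B : pzAlgType K)
    (f : {rmorphism A -> B}) : Prop :=
  forall c : K, f (alg_const c) = alg_const c.

Definition alg_isom (K : comNzRingType) (A B : pzAlgType K) : Prop :=
  exists2 f : {rmorphism A -> B}, alg_hom f & bijective f.

Section Subalgebras.
Variables (K : comNzRingType) (A : pzAlgType K).

Definition subalgebra (S : set A) : Prop :=
  [/\ forall c : K, S (alg_const c),
      forall u v, S u -> S v -> S (u + v)
    & forall u v, S u -> S v -> S (u * v)].

Record subalg := Subalg { subalg_set :> set A; subalgP : subalgebra subalg_set }.

Definition subalg_pred (S : subalg) : {pred A} := fun a => `[< subalg_set S a >].

Record subalg_type (S : subalg) : Type := SubalgElt
  { subalg_val : A; subalg_valP : subalg_val \in subalg_pred S }.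

End Subalgebras.

Section SubalgebraInstances.
Variables (K : comNzRingType) (A : pzAlgType K) (S : subalg A).

Lemma subalg_predP a : reflect ((S : set A) a) (a \in subalg_pred S).
Proof. exact: asboolP. Qed.

Fact subalg_subring_closed : subring_closed (subalg_pred S).
Proof.
case: (subalgP S) => SC SD SM; split.
- by apply/subalg_predP; rewrite -(rmorph1 (@alg_const K A)); apply: SC.
- move=> u v /subalg_predP Su /subalg_predP Sv; apply/subalg_predP; apply: SD => //.
  by rewrite -mulN1r -(rmorphN1 (@alg_const K A)); apply: SM; [exact: SC|].
- by move=> u v /subalg_predP Su /subalg_predP Sv; apply/subalg_predP; apply: SM.
Qed.
HB.instance Definition _ :=
  GRing.isSubringClosed.Build A (subalg_pred S) subalg_subring_closed.

HB.instance Definition _ := [isSub for @subalg_val K A S].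
HB.instance Definition _ := [Choice of subalg_type S by <:].
HB.instance Definition _ := GRing.SubChoice_isSubPzRing.Build
  A (subalg_pred S) (subalg_type S) subalg_subring_closed.

Definition subalg_const (c : K) : subalg_type S :=
  SubalgElt (asboolT (let: And3 SC _ _ := subalgP S in SC c)).

Fact subalg_const_zmod_morphism : zmod_morphism subalg_const.
Proof. by move=> c d; apply: val_inj; rewrite /= rmorphB. Qed.
Fact subalg_const_monoid_morphism : GRing.monoid_morphism subalg_const.
Proof.
by split=> [|c d]; apply: val_inj; rewrite /= (rmorph1, rmorphM).
Qed.
Fact subalg_constC (c : K) (u : subalg_type S) :
  subalg_const c * u = u * subalg_const c.
Proof. by apply: val_inj; rewrite /= alg_constC. Qed.
HB.instance Definition _ := isPzAlg.Build K (subalg_type S)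
  subalg_const_zmod_morphism subalg_const_monoid_morphism subalg_constC.

End SubalgebraInstances.

Section GeneratedSubalgebra.
Variables (K : comNzRingType) (A : pzAlgType K).

Fact gen_subalg_subproof (G : set A) : subalgebra (smallest (@subalgebra K A) G).
Proof.
split=> [c B [[]]//|u v Su Sv B|u v Su Sv B] BG; have [[_ BD BM] _] := BG.
  by apply: BD; [apply: Su|apply: Sv].
by apply: BM; [apply: Su|apply: Sv].
Qed.
Definition gen_subalg (G : set A) : subalg A := Subalg (gen_subalg_subproof G).

Fact center_subproof : subalgebra [set z : A | forall a, z * a = a * z].
Proof.
split=> [c a|u v uC vC a|u v uC vC a] /=; first exact: alg_constC.
  by rewrite mulrDl mulrDr uC vC.
by rewrite -mulrA vC mulrA uC mulrA.
Qed.
Definition center : subalg A := Subalg center_subproof.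

Definition finitely_generated : Prop :=
  exists s : seq A, gen_subalg [set` s] = setT :> set A.

End GeneratedSubalgebra.

Section Ideals.
Variables (K : comNzRingType) (A : pzAlgType K).

Definition twosided_ideal (I : set A) : Prop :=
  [/\ I 0,
      forall u v, I u -> I v -> I (u + v),
      forall a u, I u -> I (a * u)
    & forall a u, I u -> I (u * a)].

Definition maximal_ideal (m : set A) : Prop :=
  [/\ twosided_ideal m, m <> setT
    & forall J, twosided_ideal J -> m `<=` J -> J = m \/ J = setT].

Record ideal := Ideal { ideal_set :> set A; idealP : twosided_ideal ideal_set }.

Fact gen_ideal_subproof (G : set A) : twosided_ideal (smallest twosided_ideal G).
Proof.
split=> [B [[]]//|u v Iu Iv B|a u Iu B|a u Iu B] BG;
  have [[_ BD BMl BMr] _] := BG.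
- by apply: BD; [apply: Iu|apply: Iv].
- by apply: BMl; apply: Iu.
- by apply: BMr; apply: Iu.
Qed.
Definition gen_ideal (G : set A) : ideal := Ideal (gen_ideal_subproof G).

Definition ideal_pred (I : ideal) : {pred A} := fun a => `[< ideal_set I a >].

End Ideals.

Section Quotient.
Variables (K : comNzRingType) (A : pzAlgType K) (I : ideal A).

Lemma ideal_predP a : reflect ((I : set A) a) (a \in ideal_pred I).
Proof. exact: asboolP. Qed.

Fact ideal_zmod_closed : zmod_closed (ideal_pred I).
Proof.
case: (idealP I) => I0 ID IMl _; split; first by apply/ideal_predP.
move=> u v /ideal_predP Iu /ideal_predP Iv; apply/ideal_predP; apply: ID => //.
by rewrite -mulN1r; apply: IMl.
Qed.
HB.instance Definition _ :=
  GRing.isZmodClosed.Build A (ideal_pred I) ideal_zmod_closed.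

(* A/I, on top of the additive quotient of ring_quotient. *)
Definition quot_alg : Type := Quotient.quot (ideal_pred I).
HB.instance Definition _ := GRing.Zmodule.on quot_alg.

Definition quot_pi : A -> quot_alg := \pi_(Quotient.quot (ideal_pred I))%qT.
Definition quot_repr : quot_alg -> A := @repr _ (Quotient.quot (ideal_pred I)).

Lemma quot_reprK : cancel quot_repr quot_pi.
Proof. exact: reprK. Qed.

Lemma quot_piP u v : quot_pi u = quot_pi v <-> (I : set A) (u - v).
Proof.
rewrite /quot_pi; split.
  by move=> /eqP; rewrite -Quotient.idealrBE => /ideal_predP.
by move=> Iuv; apply/eqP; rewrite -Quotient.idealrBE; apply/ideal_predP.
Qed.

Lemma quot_piD : {morph quot_pi : u v / u + v}.
Proof. by move=> u v; rewrite /quot_pi !piE. Qed.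

Definition quot_mul : quot_alg -> quot_alg -> quot_alg :=
  locked (fun x y => quot_pi (quot_repr x * quot_repr y)).

Lemma quot_piM u v : quot_pi (u * v) = quot_mul (quot_pi u) (quot_pi v).
Proof.
rewrite /quot_mul -lock.
case: (idealP I) => _ ID IMl IMr; apply/quot_piP.
set u' := quot_repr _; set v' := quot_repr _.
have Iu : (I : set A) (u - u') by apply/quot_piP; rewrite quot_reprK.
have Iv : (I : set A) (v - v') by apply/quot_piP; rewrite quot_reprK.
have -> : u * v - u' * v' = (u - u') * v + u' * (v - v').
  by rewrite mulrBl mulrBr addrA subrK.
by apply: ID; [apply: IMr|apply: IMl].
Qed.

Fact quot_mulA : associative quot_mul.
Proof.
move=> x y z; rewrite -[x]quot_reprK -[y]quot_reprK -[z]quot_reprK.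
by rewrite -!quot_piM mulrA.
Qed.
Fact quot_mul1 : left_id (quot_pi 1) quot_mul.
Proof. by move=> x; rewrite -[x]quot_reprK -quot_piM mul1r. Qed.
Fact quot_mulr1 : right_id (quot_pi 1) quot_mul.
Proof. by move=> x; rewrite -[x]quot_reprK -quot_piM mulr1. Qed.
Fact quot_mulDl : left_distributive quot_mul +%R.
Proof.
move=> x y z; rewrite -[x]quot_reprK -[y]quot_reprK -[z]quot_reprK.
by rewrite -quot_piD -!quot_piM -quot_piD mulrDl.
Qed.
Fact quot_mulDr : right_distributive quot_mul +%R.
Proof.
move=> x y z; rewrite -[x]quot_reprK -[y]quot_reprK -[z]quot_reprK.
by rewrite -quot_piD -!quot_piM -quot_piD mulrDr.
Qed.
HB.instance Definition _ := GRing.Zmodule_isPzRing.Build quot_alg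
  quot_mulA quot_mul1 quot_mulr1 quot_mulDl quot_mulDr.

Fact quot_pi_zmod_morphism : zmod_morphism quot_pi.
Proof. by move=> u v; rewrite /quot_pi !piE. Qed.
HB.instance Definition _ :=
  GRing.isZmodMorphism.Build A quot_alg quot_pi quot_pi_zmod_morphism.
Fact quot_pi_monoid_morphism : GRing.monoid_morphism quot_pi.
Proof. by split=> // u v; rewrite quot_piM. Qed.
HB.instance Definition _ :=
  GRing.isMonoidMorphism.Build A quot_alg quot_pi quot_pi_monoid_morphism.

Definition quot_const (c : K) : quot_alg := quot_pi (alg_const c).
Fact quot_const_zmod_morphism : zmod_morphism quot_const.
Proof. by move=> c d; rewrite /quot_const !rmorphB. Qed.
Fact quot_const_monoid_morphism : GRing.monoid_morphism quot_const.
Proof. by split=> [|c d]; rewrite /quot_const ?rmorph1 ?rmorphM. Qed.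
Fact quot_constC (c : K) (x : quot_alg) : quot_const c * x = x * quot_const c.
Proof. by rewrite -[x]quot_reprK /quot_const -!rmorphM alg_constC. Qed.
HB.instance Definition _ := isPzAlg.Build K quot_alg
  quot_const_zmod_morphism quot_const_monoid_morphism quot_constC.

End Quotient.

Section Localization.
Variables (K : comNzRingType) (A : pzAlgType K).

Definition powers (a : A) : set A := [set a ^+ k | k in setT].

(* phi exhibits B as the left ring of fractions of A with respect to S: the
   elements of B are the phi(s)^-1 * phi(a), and the kernel of phi is the
   S-torsion.  When S is left and right Ore it is also the right ring of
   fractions; when A is commutative it is the usual localization. *)
Definition is_ore_localization (S : set A) (B : pzAlgType K)
    (phi : {rmorphism A -> B}) : Prop :=
  [/\ alg_hom phi,
      forall s, S s -> exists2 t, t * phi s = 1 & phi s * t = 1,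
      forall b, exists s a, S s /\ phi s * b = phi a
    & forall a, phi a = 0 <-> exists2 s, S s & s * a = 0].

End Localization.

Section Azumaya.
Variables (K : fieldType) (A : pzAlgType K).

Definition free_over_center (r : nat) : Prop :=
  exists b : 'I_r -> A, forall a : A,
    exists! c : {ffun 'I_r -> subalg_type (center A)},
      a = \sum_(i < r) val (c i) * b i.

Definition azumaya : Prop :=
  exists N : nat,
    [/\ free_over_center (N ^ 2),
        finitely_generated (subalg_type (center A))
      & forall m : set (subalg_type (center A)), maximal_ideal m ->
          alg_isom (quot_alg (gen_ideal (val @` m))) 'M[K]_N].

End Azumaya.

Section QuantumWeyl.
Variables (K : comNzRingType) (n : nat).

(* The free algebra on x_1, ..., x_n (inl) and d_1, ..., d_n (inr). *)
Definition free_alg : Type := {malg K[{fmonom ('I_n + 'I_n)%type}]}.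
HB.instance Definition _ := GRing.NzRing.on free_alg.

Definition free_const (c : K) : free_alg := malgC c.
Fact free_const_zmod_morphism : zmod_morphism free_const.
Proof. by move=> c d; rewrite /free_const raddfB. Qed.
Fact free_const_monoid_morphism : GRing.monoid_morphism free_const.
Proof. by split=> [|c d]; rewrite /free_const ?rmorph1 ?rmorphM. Qed.
Fact free_constC (c : K) (u : free_alg) : free_const c * u = u * free_const c.
Proof.
rewrite !malgM_def fgmulUg fgmulgU; apply: eq_bigr => k _.
by rewrite mul1m mulm1 mulrC.
Qed.
HB.instance Definition _ := isPzAlg.Build K free_alg
  free_const_zmod_morphism free_const_monoid_morphism free_constC.

Definition free_x (i : 'I_n) : free_alg := << fmu (inl i) >>.
Definition free_d (i : 'I_n) : free_alg := << fmu (inr i) >>.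

Variable q : K.

Definition weyl_relations : set free_alg :=
  [set r | exists i j : 'I_n,
     [\/ r = free_d i * free_x j
             - alg_const (q ^+ (i == j)) * (free_x j * free_d i) - (i == j)%:R,
         r = free_x i * free_x j - free_x j * free_x i
       | r = free_d i * free_d j - free_d j * free_d i]].

Definition qweyl : pzAlgType K := quot_alg (gen_ideal weyl_relations).

Definition weyl_pi : {rmorphism free_alg -> qweyl} :=
  quot_pi (gen_ideal weyl_relations).

Definition weyl_x (i : 'I_n) : qweyl := weyl_pi (free_x i).
Definition weyl_d (i : 'I_n) : qweyl := weyl_pi (free_d i).

Definition weyl_f : qweyl :=
  \prod_(i < n) (weyl_d i * weyl_x i - weyl_x i * weyl_d i).

(* K[x_1^l, ..., x_n^l, d_1^l, ..., d_n^l] inside qweyl. *)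
Definition weyl_Z (l : nat) : subalg qweyl :=
  gen_subalg ([set weyl_x i ^+ l | i in setT] `|` [set weyl_d i ^+ l | i in setT]).

End QuantumWeyl.

(* Main.v *)
(* Write x = x_i, d = d_i and f = d x - x d.  Then f x = q x f, d f = q f d, and
   (q - 1) x d = f - 1, (q - 1) d x = q f - 1, from which x^l and d^l commute with x and d
   and f^l is affine in d^l x^l.

   No PBW basis of the quantum Weyl algebra is needed.  In any algebra where f is invertible,
   the monomials x^a d^b (a, b < l) are independent over the centralizer of x and d.  Removing
   the pairs (x_i, d_i) one at a time, the localized algebra B is therefore free of rank
   (l^2)^n over the subalgebra generated by the x_i^l, the d_i^l and the inverse of the l-th
   power of the product of the f_i, and this subalgebra is the center of B.  Hence the center
   of B is a localization of Z, and localizations of a commutative algebra are unique.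

   For a maximal ideal m of the center, the Nullstellensatz (in its easy form over an
   uncountable field) makes every x_i^l and d_i^l a scalar in B/(m), which is nonzero by
   freeness.  The eigenprojections of the f_i, which x_i and d_i shift cyclically, then produce
   a system of l^n by l^n matrix units spanning B/(m). *)

From HB Require Import structures.
Require Import Defs.
From mathcomp Require Import all_boot all_order all_algebra.
From mathcomp Require Import boolp classical_sets reals complex.
From mathcomp Require Import cardinality constructive_ereal lebesgue_measure.
From mathcomp.multinomials Require Import -(notations) monalg.

Set Implicit Arguments.
Unset Strict Implicit.
Unset Printing Implicit Defensive.

Import GRing.Theory.
Local Open Scope classical_set_scope.
Local Open Scope ring_scope.

(** Independence of the x^a d^b rests on the invertibility of f: in K[x, 1/x] with d = 1/((1 - q) x)
    the relation holds, f = 0, and x d is a scalar. A localization is given only by its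
    characterization, so B is known through the relations, through an inverse t of the product F of
    the f_i, and through generation by the x_i, d_i and t; no embedding of the Weyl algebra into B
    is used. At the central level t^l is enough, because t = t^l F^(l-1).

    The same relations are met in the Weyl algebra, in B and in every B/(m), hence lemmas about
    elements of an arbitrary algebra. In B/(m) an x_i may be nilpotent, so it cannot be cancelled,
    and the cycle of eigenspaces of f_i may be broken. Since (q - 1) x d = f - 1, it can break only
    at the eigenvalue 1; placing that eigenvalue, if it occurs, at the start of the cycle leaves
    every step used by the matrix units invertible. *)

(** * Scalar multiplication on possibly zero algebras *)

Section Scaling.
Variable K : comNzRingType.

Section Instance.
Variable A : pzAlgType K.
(** Locked so that [*:] does not unfold to a product by a constant while products are being
    rewritten. *)
Definition pzalg_scale : K -> A -> A := locked (fun c u => alg_const c * u).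
Fact pzalg_scaleE c u : pzalg_scale c u = alg_const c * u.
Proof. by rewrite /pzalg_scale -lock. Qed.
Fact pzalg_scaleA c d u : pzalg_scale c (pzalg_scale d u) = pzalg_scale (c * d) u.
Proof. by rewrite !pzalg_scaleE rmorphM mulrA. Qed.
Fact pzalg_scale1 : left_id 1 pzalg_scale.
Proof. by move=> u; rewrite pzalg_scaleE rmorph1 mul1r. Qed.
Fact pzalg_scaleDr : right_distributive pzalg_scale +%R.
Proof. by move=> c u v; rewrite !pzalg_scaleE mulrDr. Qed.
Fact pzalg_scaleDl u : {morph pzalg_scale^~ u : c d / c + d}.
Proof. by move=> c d; rewrite !pzalg_scaleE rmorphD mulrDl. Qed.
HB.instance Definition _ := GRing.Zmodule_isLmodule.Build K (PzAlg.sort A)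
  pzalg_scaleA pzalg_scale1 pzalg_scaleDr pzalg_scaleDl.
End Instance.

Variable A : pzAlgType K.
Implicit Types (c : K) (u v : A).

Lemma alg_const_mul c u : alg_const c * u = c *: u.
Proof. exact: esym (pzalg_scaleE c u). Qed.

Lemma alg_constE c : alg_const c = c *: (1 : A).
Proof. by rewrite -alg_const_mul mulr1. Qed.

Lemma pzscalerAl c u v : c *: (u * v) = c *: u * v.
Proof. by rewrite -!alg_const_mul mulrA. Qed.

Lemma pzscalerAr c u v : c *: (u * v) = u * (c *: v).
Proof. by rewrite -!alg_const_mul mulrA alg_constC mulrA. Qed.

Lemma commrZ c u v : GRing.comm u v -> GRing.comm u (c *: v).
Proof. by rewrite /GRing.comm => uv; rewrite -pzscalerAr uv pzscalerAl. Qed.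

Lemma pzexprZn c u m : (c *: u) ^+ m = c ^+ m *: u ^+ m.
Proof.
elim: m => [|m IHm]; first by rewrite scale1r.
by rewrite !exprS IHm -pzscalerAl -pzscalerAr scalerA.
Qed.

Lemma subalgZ (S : subalg A) c u : (S : set A) u -> (S : set A) (c *: u).
Proof. by case: (subalgP S) => SC _ SM Su; rewrite -alg_const_mul; apply: SM. Qed.

End Scaling.

Lemma alg_homZ (K : comNzRingType) (A B : pzAlgType K) (f : {rmorphism A -> B})
  (c : K) (u : A) : alg_hom f -> f (c *: u) = c *: f u.
Proof. by move=> fC; rewrite -!alg_const_mul rmorphM fC. Qed.

(** * Evaluation of polynomials at an element of an algebra *)

Section Evaluation.
Variables (K : comNzRingType) (A : pzAlgType K) (u : A).
Implicit Types p r : {poly K}.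

(* horner_morph is only available for nonzero target rings. *)
Definition alg_eval p : A := \sum_(i < size p) p`_i *: u ^+ i.

Lemma alg_evalE m p : (size p <= m)%N -> alg_eval p = \sum_(i < m) p`_i *: u ^+ i.
Proof.
move=> pm; rewrite /alg_eval -!(big_mkord xpredT (fun i => p`_i *: u ^+ i)).
rewrite (big_cat_nat (leq0n _) pm) //= [X in _ + X]big_nat_cond [X in _ + X]big1 ?addr0 //.
by move=> i /andP[/andP[pi _] _]; rewrite nth_default ?scale0r.
Qed.

Lemma alg_eval0 : alg_eval 0 = 0.
Proof. by rewrite /alg_eval size_poly0 big_ord0. Qed.

Lemma alg_evalD p r : alg_eval (p + r) = alg_eval p + alg_eval r.
Proof.
pose m := maxn (size p) (size r).
rewrite (@alg_evalE m) ?size_polyD // (@alg_evalE m p) ?leq_maxl //.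
rewrite (@alg_evalE m r) ?leq_maxr // -big_split /=.
by apply: eq_bigr => i _; rewrite coefD scalerDl.
Qed.

Lemma alg_evalZ c p : alg_eval (c *: p) = c *: alg_eval p.
Proof.
rewrite (@alg_evalE (size p)) ?size_scale_leq // scaler_sumr.
by apply: eq_bigr => i _; rewrite coefZ scalerA.
Qed.

Lemma alg_evalC c : alg_eval c%:P = c *: (1 : A).
Proof. by rewrite (@alg_evalE 1) ?size_polyC_leq1 // big_ord1 coefC. Qed.

Lemma alg_eval1 : alg_eval 1 = 1.
Proof. by rewrite alg_evalC scale1r. Qed.

Lemma alg_evalMX p : alg_eval (p * 'X) = alg_eval p * u.
Proof.
rewrite (@alg_evalE (size p).+1); last first.
  by apply: leq_trans (size_polyMleq _ _) _; rewrite size_polyX addn2.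
rewrite big_ord_recl coefMX scale0r add0r mulr_suml.
by apply: eq_bigr => i _; rewrite coefMX /= -pzscalerAl exprSr.
Qed.

Lemma alg_evalX : alg_eval 'X = u.
Proof. by rewrite -['X]mul1r alg_evalMX alg_eval1 mul1r. Qed.

Lemma alg_evalM p r : alg_eval (p * r) = alg_eval p * alg_eval r.
Proof.
elim/poly_ind: r => [|r c IHr]; first by rewrite mulr0 alg_eval0 mulr0.
rewrite mulrDr mulrA !alg_evalD !alg_evalMX IHr alg_evalC mulrDr mulrA.
by congr (_ + _); rewrite mulrC mul_polyC alg_evalZ -pzscalerAr mulr1.
Qed.

Lemma alg_evalB p r : alg_eval (p - r) = alg_eval p - alg_eval r.
Proof. by rewrite alg_evalD -scaleN1r alg_evalZ scaleN1r. Qed.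

Lemma alg_evalXn m : alg_eval 'X^m = u ^+ m.
Proof.
by elim: m => [|m IHm]; rewrite ?alg_eval1 // exprSr alg_evalMX IHm exprSr.
Qed.

End Evaluation.

(** * Power sums of a primitive root of unity *)

Section RootSum.
Variables (K : fieldType) (l : nat) (q : K).
Hypothesis q_prim : l.-primitive_root q.

(** Multiplication by q^m - 1 telescopes the sum to q^(l m) - 1 = 0. This makes the spectral
    projections of [pair_matrix_units] add up to 1. *)
Lemma prim_root_sum m :
  \sum_(i < l) q ^+ (i * m) = if (l %| m)%N then l%:R else 0.
Proof.
case: ifP => [|lm].
  rewrite (prim_order_dvd q_prim) => /eqP qm.
  rewrite -[l in RHS]card_ord -sum1_card natr_sum; apply: eq_bigr => i _.
  by rewrite mulnC exprM qm expr1n.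
apply: (@mulfI _ (q ^+ m - 1)).
  by rewrite subr_eq0 -(prim_order_dvd q_prim) lm.
under eq_bigr do rewrite mulnC exprM.
by rewrite -subrX1 -exprM mulnC exprM (prim_expr_order q_prim) expr1n subrr mulr0.
Qed.

End RootSum.

(** * Calculus of one q-Weyl pair *)

Section QWeylPair.
Variables (K : fieldType) (l : nat) (q : K).
Hypotheses (q_prim : l.-primitive_root q) (l_gt1 : (1 < l)%N).

Lemma prim_neq0 : q != 0.
Proof. by rewrite (prim_root_eq0 q_prim) -lt0n (prim_order_gt0 q_prim). Qed.

Lemma prim_inv : q^-1 = q ^+ l.-1.
Proof.
apply: (mulfI prim_neq0); rewrite mulfV ?prim_neq0 //.
by rewrite -exprS prednK ?(prim_order_gt0 q_prim) // (prim_expr_order q_prim).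
Qed.

Lemma prim_rootV : l.-primitive_root (q^-1).
Proof.
rewrite prim_inv (prim_root_exp_coprime _ q_prim).
by rewrite -[X in coprime _ X](prednK (prim_order_gt0 q_prim)) coprimenS.
Qed.

Lemma prim_subr1_neq0 m : ~~ (l %| m)%N -> q ^+ m - 1 != 0.
Proof. by rewrite subr_eq0 -(prim_order_dvd q_prim). Qed.

Lemma q1_neq0 : q - 1 != 0.
Proof.
rewrite -(expr1 q) prim_subr1_neq0 // dvdn1.
by apply: contraTneq l_gt1 => ->.
Qed.

(** Allows identities to be checked after scaling by q - 1, where [x * d] and [d * x] become affine
    in [f]. *)
Lemma q1I (A : pzAlgType K) : injective (fun u : A => (q - 1) *: u).
Proof. exact/scalerI/q1_neq0. Qed.

Variables (A : pzAlgType K) (x d : A).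
Hypothesis dxE : d * x = q *: (x * d) + 1.
Let f := d * x - x * d.

Lemma pair_xd : (q - 1) *: (x * d) = f - 1.
Proof. by rewrite /f dxE scalerBl scale1r addrAC addrK. Qed.

Lemma pair_dx : (q - 1) *: (d * x) = q *: f - 1.
Proof.
rewrite -[d * x](subrK (x * d)) -/f scalerDr pair_xd.
by rewrite addrA scalerBl scale1r subrK.
Qed.

Lemma pair_f : f = (q - 1) *: (x * d) + 1.
Proof. by rewrite pair_xd subrK. Qed.

Lemma pair_fx : f * x = q *: (x * f).
Proof.
rewrite {1}pair_f mulrDl mul1r -pzscalerAl -mulrA pzscalerAr pair_dx.
by rewrite mulrBr mulr1 subrK pzscalerAr.
Qed.

Lemma pair_df : d * f = q *: (f * d).
Proof.
rewrite {1}pair_f mulrDr mulr1 -pzscalerAr mulrA pzscalerAl pair_dx.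
by rewrite mulrBl mul1r subrK pzscalerAl.
Qed.

Lemma pair_fx1n m : f * x ^+ m = q ^+ m *: (x ^+ m * f).
Proof.
elim: m => [|m IHm]; first by rewrite mulr1 mul1r scale1r.
rewrite exprSr mulrA IHm -pzscalerAl -mulrA pair_fx -pzscalerAr scalerA.
by rewrite [q ^+ m.+1]exprSr mulrA.
Qed.

Lemma pair_fxn j m : f ^+ j * x ^+ m = q ^+ (j * m) *: (x ^+ m * f ^+ j).
Proof.
elim: j => [|j IHj]; first by rewrite mul1r mulr1 scale1r.
rewrite exprS -mulrA IHj -pzscalerAr mulrA pair_fx1n -pzscalerAl scalerA -mulrA.
by rewrite -exprD mulSn addnC.
Qed.

Lemma pair_dnf m : d ^+ m * f = q ^+ m *: (f * d ^+ m).
Proof.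
elim: m => [|m IHm]; first by rewrite mulr1 mul1r scale1r.
by rewrite exprSr -mulrA pair_df -pzscalerAr mulrA IHm -pzscalerAl scalerA -exprS mulrA.
Qed.

(** For m + 1 = l the power of q drops out and the right side is x^(l-1) (f - 1) = (q - 1) x^l d,
    which is why x^l commutes with d. For smaller m this is the lowering action of d on powers of
    x. *)
Lemma pair_dxS m : (q - 1) *: (d * x ^+ m.+1) = x ^+ m * (q ^+ m.+1 *: f - 1).
Proof.
rewrite exprS mulrA pzscalerAl pair_dx mulrBl mul1r mulrBr mulr1 -pzscalerAl -pzscalerAr.
by rewrite pair_fx1n scalerA -exprS.
Qed.

Lemma pair_dSx m : (q - 1) *: (d ^+ m.+1 * x) = d ^+ m * (q *: f - 1).
Proof. by rewrite exprSr -mulrA pzscalerAr pair_dx. Qed.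

Lemma pair_comm_d_xl : GRing.comm d (x ^+ l).
Proof.
apply: q1I; rewrite -(prednK (prim_order_gt0 q_prim)) pair_dxS.
rewrite prednK ?(prim_order_gt0 q_prim) // (prim_expr_order q_prim) scale1r.
by rewrite -pair_xd -pzscalerAr mulrA -exprSr prednK ?(prim_order_gt0 q_prim).
Qed.

Lemma pair_comm_x_dl : GRing.comm x (d ^+ l).
Proof.
apply: q1I; rewrite -(prednK (prim_order_gt0 q_prim)) pair_dSx.
rewrite exprS mulrA pzscalerAl pair_xd mulrBr mulrBl mulr1 mul1r -pzscalerAr pair_dnf.
rewrite scalerA -exprS prednK ?(prim_order_gt0 q_prim) //.
by rewrite (prim_expr_order q_prim) scale1r.
Qed.

Lemma pair_comm_f u : GRing.comm u x -> GRing.comm u d -> GRing.comm u f.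
Proof. by move=> ux ud; apply: commrB; apply: commrM. Qed.

Definition pair_poly b : {poly K} := \prod_(j < b) (q ^+ j.+1 *: 'X - 1).

(** By [pair_dxS], each d cancels one x and leaves one linear factor in [f]. *)
Lemma pair_dnxn b : (q - 1) ^+ b *: (d ^+ b * x ^+ b) = alg_eval f (pair_poly b).
Proof.
elim: b => [|b IHb].
  by rewrite /pair_poly big_ord0 alg_eval1 mulr1 scale1r.
rewrite /pair_poly big_ord_recr /= -/(pair_poly b) alg_evalM -IHb.
rewrite alg_evalB alg_evalZ alg_evalX alg_eval1 [(q - 1) ^+ _]exprSr -scalerA.
rewrite [d ^+ b.+1]exprSr -mulrA pzscalerAr pair_dxS mulrA -pzscalerAl.
by [].
Qed.

(** The roots q^-1, ..., q^-l of [pair_poly l] are all the l-th roots of unity, so this polynomial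
    is a multiple of X^l - 1, and [pair_dnxn] at b = l is the claim. *)
Lemma pair_fl : exists c : K, f ^+ l = 1 + c *: (d ^+ l * x ^+ l).
Proof.
have q0 := prim_neq0; have l_gt0 := prim_order_gt0 q_prim.
have qV_prim := prim_rootV.
(* The leading coefficient of [pair_poly l]. *)
pose k := \prod_(j < l) q ^+ j.+1.
have k0 : k != 0 by apply/prodf_neq0 => j _; rewrite expf_neq0.
exists (k^-1 * (q - 1) ^+ l); rewrite -scalerA pair_dnxn.
suff -> : pair_poly l = k *: ('X^l - 1).
  by rewrite alg_evalZ alg_evalB alg_evalXn alg_eval1 scalerA mulVf // scale1r addrC subrK.
have -> : 'X^l - 1 = \prod_(j < l) ('X - (q^-1 ^+ j.+1)%:P) :> {poly K}.
  (* The standard factorization runs over the exponents 0, ..., l - 1; the factor at 0 is moved to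
     the end, as the factor at l. *)
  rewrite -(factor_Xn_sub_1 qV_prim) big_mkord -(prednK l_gt0).
  rewrite big_ord_recl big_ord_recr /= prednK // (prim_expr_order qV_prim) expr0 mulrC.
  by congr (_ * _); apply: eq_bigr.
rewrite -scaler_prod; apply: eq_bigr => j _.
by rewrite scalerBr -mul_polyC -mul_polyC -polyCM -exprMn divff // expr1n.
Qed.

End QWeylPair.

(** * Linear independence of the monomials of one pair *)

Section Independence.
Variables (K : fieldType) (l : nat) (q : K).
Hypotheses (q_prim : l.-primitive_root q) (l_gt1 : (1 < l)%N).
Variables (A : pzAlgType K) (x d : A).
Hypothesis dxE : d * x = q *: (x * d) + 1.
Local Notation f := (d * x - x * d).
Hypothesis f_unit : exists t, f * t = 1.

Lemma pair_fnI j (u : A) : u * f ^+ j = 0 -> u = 0.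
Proof.
have [t ft] := f_unit; elim: j => [|j IHj]; first by rewrite mulr1.
move=> u0; apply: IHj; rewrite -[LHS]mulr1 -ft mulrA -[_ * f]mulrA -exprSr u0.
exact: mul0r.
Qed.

(** The condition on [k 0] is what matters: it makes p_0 the constant term, in powers of d, of p_0
    f^m. *)
Lemma pair_fn_expand m : exists2 k : nat -> K, k 0 = 1 &
  f ^+ m = \sum_(b < m.+1) k b *: (x ^+ b * d ^+ b).
Proof.
elim: m => [|m [k k0 fm]].
  by exists (fun=> 1) => //; rewrite big_ord1 scale1r mulr1.
(* Writing the last factor of f^(m+1) as (q - 1) x d + 1 and moving f^m across x at the cost of q^m
   gives this q-Pascal recursion. The guard is there because [k] is arbitrary beyond m. *)
pose k' b := (if (b <= m)%N then k b else 0)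
  + (if b is b'.+1 then (q - 1) * q ^+ m * k b' else 0).
exists k'; first by rewrite /k' addr0.
rewrite exprSr {2}(pair_f dxE) mulrDr mulr1 addrC.
rewrite -pzscalerAr mulrA -[f ^+ m * x]/(f ^+ m * x ^+ 1) (pair_fxn dxE) muln1 -pzscalerAl scalerA.
under [RHS]eq_bigr do rewrite scalerDl.
rewrite big_split /=; congr (_ + _).
  rewrite big_ord_recr /= ltnn scale0r addr0 fm; apply: eq_bigr => i _.
  by rewrite -ltnS ltn_ord.
rewrite big_ord_recl scale0r add0r fm mulr_sumr mulr_suml scaler_sumr.
apply: eq_bigr => i _; rewrite /= -pzscalerAr -pzscalerAl scalerA.
by rewrite add0n expr1 -!mulrA -exprSr (mulrA x) -exprS.
Qed.

Lemma pair_dnx b : (q - 1) *: (d ^+ b.+1 * x) =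
  ((q - 1) * q ^+ b.+1) *: (x * d ^+ b.+1) + (q ^+ b.+1 - 1) *: d ^+ b.
Proof.
rewrite (pair_dSx dxE) mulrBr mulr1 -pzscalerAr (pair_dnf dxE) scalerA -exprS.
rewrite {1}(pair_f dxE) mulrDl mul1r scalerDr [in RHS]scalerBl [1 *: _]scale1r addrA.
by rewrite -pzscalerAl scalerA -mulrA -exprS [q ^+ _ * _]mulrC.
Qed.

(** The factor q^b - q^m vanishes at b = m, so this q-commutator with x lowers the degree in d; this
    drives the induction on m in [pair_indep_d]. *)
Lemma pair_qcomm_sum m (p : nat -> A) :
  (forall b, GRing.comm (p b) x) ->
  let u := \sum_(b < m.+1) p b * d ^+ b in
  (q - 1) *: (u * x - q ^+ m *: (x * u)) =
  \sum_(b < m) (((q - 1) * (q ^+ b - q ^+ m)) *: (x * p b)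
                + (q ^+ b.+1 - 1) *: p b.+1) * d ^+ b.
Proof.
move=> px u.
have comm_term b : (q - 1) *: (p b * d ^+ b * x - q ^+ m *: (x * (p b * d ^+ b)))
    = ((q - 1) * (q ^+ b - q ^+ m)) *: (x * p b * d ^+ b)
      + (if b is b'.+1 then (q ^+ b - 1) *: (p b * d ^+ b') else 0).
  rewrite scalerBr -mulrA pzscalerAr mulrBr [in RHS]scalerBl scalerA mulrA.
  case: b => [|b].
    by rewrite !expr0 !mulr1 mul1r addr0 -pzscalerAr px.
  rewrite pair_dnx mulrDr -!pzscalerAr mulrA px.
  by rewrite addrAC.
rewrite /u mulr_suml mulr_sumr !scaler_sumr -sumrB scaler_sumr.
under eq_bigr do rewrite comm_term.
rewrite big_split /= big_ord_recr /= subrr mulr0 scale0r addr0.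
rewrite [X in _ + X]big_ord_recl add0r -big_split /=.
by apply: eq_bigr => b _; rewrite [RHS]mulrDl !pzscalerAl.
Qed.

(* If u = sum p_b d^b satisfies u x = q^m x u, comparing coefficients by induction gives
   p_{b+1} proportional to x p_b.  Both sum p_b d^b = 0 and p_0 f^m satisfy it, and their
   difference has no constant term, so p_0 f^m = 0. *)
Lemma pair_indep_d m (p : nat -> A) : (m <= l)%N ->
  (forall b, GRing.comm (p b) x) ->
  \sum_(b < m) p b * d ^+ b = 0 -> forall b, (b < m)%N -> p b = 0.
Proof.
elim: m p => [//|m IHm] p ml px.
have kill (r : nat -> A) : (forall b, GRing.comm (r b) x) -> r 0 = 0 ->
    let u := \sum_(b < m.+1) r b * d ^+ b in
    u * x = q ^+ m *: (x * u) -> forall b, (b < m.+1)%N -> r b = 0.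
  move=> rx r0 u ux; have := pair_qcomm_sum m rx; rewrite /= -/u ux subrr scaler0.
  move=> /esym /(IHm (fun b => ((q - 1) * (q ^+ b - q ^+ m)) *: (x * r b)
                + (q ^+ b.+1 - 1) *: r b.+1)) H.
  elim=> [//|b IHb] bm; have := H (ltnW ml) _ b bm.
  rewrite IHb ?(ltnW bm) // mulr0 scaler0 add0r => H0.
  apply: (scalerI (prim_subr1_neq0 q_prim (m := b.+1) _)).
    by rewrite gtnNdvd // (leq_trans bm).
  rewrite scaler0 H0 // => b'; apply: commr_sym.
  by apply: commrD; apply: commrZ; [apply: commrM|]; apply: commr_sym.
move=> p0.
have [k k0 fm] := pair_fn_expand m.
pose r b := p b - k b *: (p 0 * x ^+ b).
have rx b : GRing.comm (r b) x.
  apply: commr_sym; apply: commrB; first exact: commr_sym.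
  by apply: commrZ; apply: commrM; [exact: commr_sym|exact: commrX].
have rE : \sum_(b < m.+1) r b * d ^+ b = - (p 0 * f ^+ m).
  under eq_bigr do rewrite mulrBl.
  rewrite sumrB p0 add0r fm mulr_sumr; congr (- _); apply: eq_bigr => b _.
  by rewrite -pzscalerAl -pzscalerAr mulrA.
have {}r0 : forall b, (b < m.+1)%N -> r b = 0.
  apply: kill => //; first by rewrite /r k0 scale1r mulr1 subrr.
  rewrite rE mulNr mulrN scalerN; congr (- _).
  have := pair_fxn dxE m 1; rewrite muln1 expr1 => fmx.
  by rewrite -mulrA fmx -pzscalerAr !mulrA px.
have p00 : p 0 = 0.
  apply: (@pair_fnI m); rewrite -[LHS]opprK -rE big1 ?oppr0 // => b _.
  by rewrite r0 ?mul0r.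
by apply: kill => //; rewrite p0 mul0r mulr0 scaler0.
Qed.

(** Since [x] may be nilpotent, it is removed by applying [d] instead: in d x^(m+1) c the term
    x^(m+1) d c = x^(m+1) c d is zero, and what remains is (q^(m+1) - 1) x^m c up to a nonzero
    scalar. *)
Lemma pair_xnI m (c : A) : (m < l)%N -> GRing.comm c d -> x ^+ m * c = 0 -> c = 0.
Proof.
move=> ml cd; elim: m ml => [|m IHm] ml; first by rewrite mul1r.
move=> xc; apply: IHm; first exact: ltnW.
apply: (scalerI (prim_subr1_neq0 q_prim (m := m.+1) _)); first by rewrite gtnNdvd.
have := pair_dxS dxE m; rewrite (pair_f dxE) scalerDr => /(congr1 (fun u => u * c)).
rewrite -pzscalerAl -mulrA xc mulr0 scaler0 scaler0 => /esym.
have qB : q ^+ m.+1 *: (1 : A) - 1 = (q ^+ m.+1 - 1) *: (1 : A) by rewrite scalerBl scale1r.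
rewrite scalerA -addrA qB mulrDr mulrDl.
rewrite -!pzscalerAr mulr1 mulrA -exprSr -!pzscalerAl -[x ^+ _ * d * c]mulrA -cd mulrA xc.
by rewrite mul0r scaler0 add0r.
Qed.

(** The c_a commute with [f] and f x^a = q^a x^a f, so the terms are eigenvectors of conjugation by
    [f] with distinct eigenvalues q^a. Multiplying the relation by [f] on the left and subtracting
    q^m times its product on the right removes the top term; the surviving c_m x^m is settled by
    [pair_xnI]. *)
Lemma pair_indep_x m (c : nat -> A) : (m <= l)%N ->
  (forall a, GRing.comm (c a) x) -> (forall a, GRing.comm (c a) d) ->
  \sum_(a < m) c a * x ^+ a = 0 -> forall a, (a < m)%N -> c a = 0.
Proof.
elim: m c => [//|m IHm] c ml cx cd c0.
have cm a : (a < m)%N -> c a = 0.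
  move=> am; have qam : q ^+ a - q ^+ m != 0.
    rewrite subr_eq0 (eq_prim_root_expr q_prim) !modn_small ?(ltn_trans am) //.
    by rewrite neq_ltn am.
  apply: (scalerI qam); rewrite scaler0.
  apply: (IHm (fun a => (q ^+ a - q ^+ m) *: c a)) am; first exact: ltnW.
  - by move=> b; apply/commr_sym/commrZ/commr_sym.
  - by move=> b; apply/commr_sym/commrZ/commr_sym.
  apply: (@pair_fnI 1); rewrite mulr_suml.
  transitivity (f * \sum_(a < m.+1) c a * x ^+ a
                - q ^+ m *: ((\sum_(a < m.+1) c a * x ^+ a) * f)).
    rewrite mulr_sumr mulr_suml scaler_sumr -sumrB big_ord_recr /=.
    have term b : f * (c b * x ^+ b) - q ^+ m *: (c b * x ^+ b * f)
        = (q ^+ b - q ^+ m) *: c b * x ^+ b * f ^+ 1.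
      have fc : f * c b = c b * f by apply/commr_sym/pair_comm_f.
      rewrite mulrA fc -mulrA (pair_fx1n dxE) -pzscalerAr mulrA -scalerBl.
      by rewrite expr1 -!pzscalerAl.
    rewrite term subrr scale0r !mul0r addr0.
    by apply: eq_bigr => b _; rewrite term.
  by rewrite c0 mulr0 mul0r scaler0 subrr.
move=> a; rewrite ltnS leq_eqVlt => /orP[/eqP->|]; last exact: cm.
move: c0; rewrite big_ord_recr /= big1 ?add0r => [|b _]; last by rewrite cm ?mul0r.
by rewrite (commrX _ (cx m)); apply: pair_xnI.
Qed.

(** Grouped by powers of d, the coefficients are polynomials in x, which commute with x but not with
    d. This is why [pair_indep_d] asks only for commutation with x. *)
Lemma pair_indep (c : nat -> nat -> A) :
  (forall a b, GRing.comm (c a b) x) -> (forall a b, GRing.comm (c a b) d) ->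
  \sum_(a < l) \sum_(b < l) c a b * (x ^+ a * d ^+ b) = 0 ->
  forall a b, (a < l)%N -> (b < l)%N -> c a b = 0.
Proof.
move=> cx cd; rewrite exchange_big /= => c0 a b al bl.
apply: (@pair_indep_x l (c^~ b)) => //.
apply: (@pair_indep_d l (fun b => \sum_(a < l) c a b * x ^+ a)) => //.
  move=> b'; apply: commr_sym; apply: commr_sum => i _.
  by apply: commrM; [exact: commr_sym|exact: commrX].
rewrite -[RHS]c0; apply: eq_bigr => b' _; rewrite mulr_suml.
by apply: eq_bigr => a' _; rewrite mulrA.
Qed.

End Independence.

(** * Membership and induction in generated subalgebras *)

Section GeneratedSubalgebras.
Variables (K : comNzRingType) (A : pzAlgType K).
Implicit Types (S T : subalg A) (G H : set A) (u v : A).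

Lemma subalg_mem0 S : (S : set A) 0.
Proof. by case: (subalgP S) => SC _ _; rewrite -(rmorph0 (@alg_const K A)); apply: SC. Qed.

Lemma subalg_mem1 S : (S : set A) 1.
Proof. by case: (subalgP S) => SC _ _; rewrite -(rmorph1 (@alg_const K A)); apply: SC. Qed.

Lemma subalg_memD S u v : (S : set A) u -> (S : set A) v -> (S : set A) (u + v).
Proof. by case: (subalgP S) => _ SD _; apply: SD. Qed.

Lemma subalg_memM S u v : (S : set A) u -> (S : set A) v -> (S : set A) (u * v).
Proof. by case: (subalgP S) => _ _ SM; apply: SM. Qed.

Lemma subalg_memB S u v : (S : set A) u -> (S : set A) v -> (S : set A) (u - v).
Proof. by move=> Su Sv; rewrite -scaleN1r; apply/subalg_memD/subalgZ. Qed.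

Lemma subalg_memX S u m : (S : set A) u -> (S : set A) (u ^+ m).
Proof.
by move=> Su; elim: m => [|m IHm]; [exact: subalg_mem1|rewrite exprS; apply: subalg_memM].
Qed.

Lemma subalg_mem_sum S (I : finType) (F : I -> A) :
  (forall i, (S : set A) (F i)) -> (S : set A) (\sum_i F i).
Proof.
by move=> SF; apply: big_ind => // [|u v]; [exact: subalg_mem0|exact: subalg_memD].
Qed.

Lemma subalg_mem_prod S (I : Type) (r : seq I) (F : I -> A) :
  (forall i, (S : set A) (F i)) -> (S : set A) (\prod_(i <- r) F i).
Proof.
by move=> SF; apply: big_ind => // [|u v]; [exact: subalg_mem1|exact: subalg_memM].
Qed.

Lemma gen_subalg_sub S G : G `<=` S -> gen_subalg G `<=` S.
Proof. by move=> GS; apply: smallest_sub => //; apply: subalgP. Qed.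

Lemma mem_gen_subalg G u : G u -> (gen_subalg G : set A) u.
Proof. exact: sub_gen_smallest. Qed.

Lemma gen_subalg_ind (P : A -> Prop) G :
  (forall u, G u -> P u) -> (forall c : K, P (c *: (1 : A))) ->
  (forall u v, P u -> P v -> P (u + v)) -> (forall u v, P u -> P v -> P (u * v)) ->
  forall u, (gen_subalg G : set A) u -> P u.
Proof.
move=> PG PC PD PM; have Psub : subalgebra [set u | P u].
  by split=> // c; rewrite /= alg_constE.
exact: (@gen_subalg_sub (Subalg Psub) G PG).
Qed.

Lemma gen_subalg_comm G v : (forall u, G u -> GRing.comm v u) ->
  forall u, (gen_subalg G : set A) u -> GRing.comm v u.
Proof.
move=> vG; apply: gen_subalg_ind => //; last by move=> u w; apply: commrM.
  by move=> c; apply/commrZ/commr1.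
by move=> u w; apply: commrD.
Qed.

(** Induction for sets that are linear but not visibly multiplicative, such as spans. The claim is
    strengthened to [P (u * v)] for every [v] satisfying [P]. *)
Lemma gen_subalg_lmul (P : A -> Prop) G :
  (forall u v, P u -> P v -> P (u + v)) ->
  (forall (c : K) u, P u -> P (c *: u)) ->
  (forall u v, G u -> P v -> P (u * v)) ->
  P 1 -> forall u, (gen_subalg G : set A) u -> P u.
Proof.
move=> PD PZ PM P1 u Gu; rewrite -[u]mulr1; move: 1 P1.
elim/gen_subalg_ind: u / Gu => [u Gu v|c v|u w IHu IHw v Pv|u w IHu IHw v Pv].
- exact: PM.
- by move=> Pv; rewrite -pzscalerAl mul1r; apply: PZ.
- by rewrite mulrDl; apply: PD; [apply: IHu|apply: IHw].
- by rewrite -mulrA; apply/IHu/IHw.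
Qed.

End GeneratedSubalgebras.

(** * Families of mutually commuting q-Weyl pairs *)

Section QWeylFamily.
Variables (K : fieldType) (l n : nat) (q : K).
Hypotheses (q_prim : l.-primitive_root q) (l_gt1 : (1 < l)%N).

(** Relations imposed on elements of any algebra, so that the same lemmas serve the Weyl algebra,
    its localization and the quotients of the latter. *)
Definition qweyl_family (A : pzAlgType K) (x d : 'I_n -> A) : Prop :=
  [/\ forall i j, d i * x j = q ^+ (i == j) *: (x j * d i) + (i == j)%:R,
      forall i j, x i * x j = x j * x i
    & forall i j, d i * d j = d j * d i].

Definition family_f (A : pzAlgType K) (x d : 'I_n -> A) i := d i * x i - x i * d i.

Variables (A : pzAlgType K) (x d : 'I_n -> A).
Hypothesis xd_family : qweyl_family x d.
Local Notation f := (family_f x d).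

Lemma family_dx i : d i * x i = q *: (x i * d i) + 1.
Proof. by case: xd_family => -> _ _; rewrite eqxx. Qed.

Lemma family_comm_xx i j : GRing.comm (x i) (x j).
Proof. by case: xd_family. Qed.

Lemma family_comm_dd i j : GRing.comm (d i) (d j).
Proof. by case: xd_family. Qed.

Lemma family_comm_dx i j : i != j -> GRing.comm (d i) (x j).
Proof.
by case: xd_family => dx _ _ /negPf ij; rewrite /GRing.comm dx ij scale1r addr0.
Qed.

Definition family_comm (u : A) := forall i, GRing.comm u (x i) /\ GRing.comm u (d i).

Lemma family_comm_xl i : family_comm (x i ^+ l).
Proof.
move=> j; split; apply/commr_sym; first exact/commrX/family_comm_xx.
have [->|ji] := eqVneq j i; last exact/commrX/family_comm_dx.
exact (pair_comm_d_xl q_prim l_gt1 (family_dx i)).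
Qed.

Lemma family_comm_dl i : family_comm (d i ^+ l).
Proof.
move=> j; split; apply/commr_sym; last exact/commrX/family_comm_dd.
have [->|ji] := eqVneq j i; last first.
  by apply/commrX/commr_sym/family_comm_dx; rewrite eq_sym.
exact (pair_comm_x_dl q_prim l_gt1 (family_dx i)).
Qed.

Lemma family_comm_fi u i : family_comm u -> GRing.comm u (f i).
Proof. by move=> /(_ i)[ux ud]; apply: pair_comm_f. Qed.

Lemma family_comm_x_f i j : i != j -> GRing.comm (x i) (f j).
Proof.
move=> ij; apply: pair_comm_f; first exact: family_comm_xx.
by apply/commr_sym/family_comm_dx; rewrite eq_sym.
Qed.

Lemma family_comm_d_f i j : i != j -> GRing.comm (d i) (f j).
Proof.
by move=> ij; apply: pair_comm_f; [exact: family_comm_dx|exact: family_comm_dd].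
Qed.

Lemma family_comm_ff i j : GRing.comm (f i) (f j).
Proof.
have [->//|ij] := eqVneq i j; apply/commr_sym/pair_comm_f; apply/commr_sym.
  exact: family_comm_x_f.
exact: family_comm_d_f.
Qed.

Lemma family_prod_exp (r : seq 'I_n) m :
  (\prod_(i <- r) f i) ^+ m = \prod_(i <- r) f i ^+ m.
Proof.
elim: r => [|i r IHr]; first by rewrite !big_nil expr1n.
rewrite !big_cons exprMn_comm ?IHr //.
by apply: commr_prod => j _; apply: family_comm_ff.
Qed.

Lemma family_prod_factor (r : seq 'I_n) i : i \in r ->
  exists g, \prod_(j <- r) f j = f i * g.
Proof.
elim: r => // j r IHr; rewrite inE big_cons => /orP[/eqP->|/IHr[g ->]].
  by eexists.
by exists (f j * g); rewrite !mulrA family_comm_ff.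
Qed.

Definition family_powers : set A :=
  [set x i ^+ l | i in setT] `|` [set d i ^+ l | i in setT].

Lemma family_fl_gen i : (gen_subalg family_powers : set A) (f i ^+ l).
Proof.
have [c ->] := pair_fl q_prim (family_dx i).
apply: subalg_memD; first exact: subalg_mem1.
by apply/subalgZ/subalg_memM; apply: mem_gen_subalg; [right|left]; exists i.
Qed.

Lemma family_prod_fl_gen :
  (gen_subalg family_powers : set A) ((\prod_i f i) ^+ l).
Proof. by rewrite family_prod_exp; apply: subalg_mem_prod => i; apply: family_fl_gen. Qed.

Lemma family_powers_comm u : (gen_subalg family_powers : set A) u -> family_comm u.
Proof.
move=> Gu i; split; apply/commr_sym; move: u Gu; apply: gen_subalg_comm => _
  [][j _ <-]; apply/commr_sym; by [case: (family_comm_xl j i)|case: (family_comm_dl j i)].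
Qed.

End QWeylFamily.

(** * Transport of families along algebra morphisms *)

Section FamilyMorphism.
Variables (K : fieldType) (n : nat) (q : K).
Variables (A B : pzAlgType K) (phi : {rmorphism A -> B}).
Hypothesis phiC : alg_hom phi.

Lemma gen_subalg_image (G : set A) u :
  (gen_subalg G : set A) u -> (gen_subalg (phi @` G) : set B) (phi u).
Proof.
elim/gen_subalg_ind: u / => [u Gu|c|u v Gu Gv|u v Gu Gv].
- by apply: mem_gen_subalg; exists u.
- by rewrite (alg_homZ _ _ phiC) rmorph1; apply/subalgZ/subalg_mem1.
- by rewrite rmorphD; apply: subalg_memD.
- by rewrite rmorphM; apply: subalg_memM.
Qed.

Variables (x d : 'I_n -> A).

Lemma alg_hom_family : qweyl_family q x d ->
  qweyl_family q (fun i => phi (x i)) (fun i => phi (d i)).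
Proof.
case=> dx xx dd; split=> i j.
- by rewrite -rmorphM dx rmorphD rmorph_nat (alg_homZ _ _ phiC) rmorphM.
- by rewrite -!rmorphM xx.
- by rewrite -!rmorphM dd.
Qed.

Lemma rmorph_family_prod : phi (\prod_(i < n) family_f x d i) =
  \prod_(i < n) family_f (fun i => phi (x i)) (fun i => phi (d i)) i.
Proof. by rewrite rmorph_prod; apply: eq_bigr => i _; rewrite rmorphB !rmorphM. Qed.

End FamilyMorphism.

(** * Free modules over a subalgebra *)

Section FreeOn.
Variables (K : comNzRingType) (A : pzAlgType K).
Implicit Types S T U : set A.

(** The coefficients stay in [A] instead of a subtype, so that bases of successive levels can be
    multiplied. *)
Definition free_on S T (I : finType) (e : I -> A) : Prop :=
  [/\ forall u, S u -> exists2 c : I -> A, (forall i, T (c i)) & u = \sum_i c i * e i,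
      forall c : I -> A, (forall i, T (c i)) -> \sum_i c i * e i = 0 -> forall i, c i = 0
    & forall i, S (e i)].

(** The degree formula of a tower: coefficients in [T] are expanded over [U], hence the inner basis
    stands on the left. *)
Lemma free_on_trans (S T U : subalg A) (I J : finType) (e : I -> A) (g : J -> A) :
  T `<=` S -> U `<=` T -> free_on S T e -> free_on T U g ->
  free_on S U (fun ij : I * J => g ij.2 * e ij.1).
Proof.
move=> TS UT [Sspan Sindep Se] [Tspan Tindep Tg]; split.
- move=> u /Sspan[c Tc ->]; have /choice[k kP] : forall i, exists k : J -> A,
      (forall j, (U : set A) (k j)) /\ c i = \sum_j k j * g j.
    by move=> i; have [k Uk ck] := Tspan _ (Tc i); exists k.
  exists (fun ij => k ij.1 ij.2) => [ij|]; first by have [] := kP ij.1.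
  rewrite -(pair_bigA _ (fun i j => k i j * (g j * e i))) /=; apply: eq_bigr => i _.
  by have [_ ->] := kP i; rewrite mulr_suml; apply: eq_bigr => j _; rewrite mulrA.
- move=> c Uc c0; have {}c0 : \sum_i \sum_j c (i, j) * (g j * e i) = 0.
    by rewrite -[RHS]c0 pair_bigA; apply: eq_bigr => -[].
  have ci0 i : \sum_j c (i, j) * g j = 0.
    apply: (Sindep (fun i => \sum_j c (i, j) * g j)) => [i'|].
      by apply: subalg_mem_sum => j; apply: subalg_memM => //; apply: UT.
    rewrite -[RHS]c0; apply: eq_bigr => i' _; rewrite mulr_suml.
    by apply: eq_bigr => j _; rewrite mulrA.
  by case=> i j; apply: (Tindep (fun j => c (i, j))).
by case=> i j; apply: subalg_memM => //; apply: TS.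
Qed.

End FreeOn.

(** * The tower from the localized algebra down to its center *)

Section LocalizedFamily.
Variables (K : fieldType) (l n : nat) (q : K).
Hypotheses (q_prim : l.-primitive_root q) (l_gt1 : (1 < l)%N).
Variables (A : pzAlgType K) (x d : 'I_n -> A) (t : A).
Hypothesis xd_family : qweyl_family q x d.
Local Notation F := (\prod_i family_f x d i).
Hypotheses (Ft : F * t = 1) (tF : t * F = 1).

(* tower 0 is the whole algebra, and tower n turns out to be its center. *)
Definition tower_gens k : set A := family_powers l x d `|` [set t ^+ l]
  `|` [set u | exists i : 'I_n, (k <= i)%N /\ (u = x i \/ u = d i)].
Definition tower k : subalg A := gen_subalg (tower_gens k).

Lemma family_f_unit i : exists g, family_f x d i * g = 1.
Proof.
have [//|g Fg] := family_prod_factor xd_family (r := index_enum 'I_n) (i := i).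
  by rewrite mem_index_enum.
by exists (g * t); rewrite mulrA -Fg.
Qed.

Lemma family_comm_t u : GRing.comm u F -> GRing.comm u t.
Proof.
move=> uF; rewrite /GRing.comm -[LHS]mul1r -tF -mulrA (mulrA F) -uF -!mulrA.
by rewrite Ft mulr1.
Qed.

Lemma family_comm_tl : family_comm x d (t ^+ l).
Proof.
have Fl : F ^+ l * t ^+ l = 1.
  by rewrite -exprMn_comm ?Ft ?expr1n // /GRing.comm Ft tF.
have lF : t ^+ l * F ^+ l = 1.
  by rewrite -exprMn_comm ?tF ?expr1n // /GRing.comm Ft tF.
have FlC : family_comm x d (F ^+ l).
  exact (family_powers_comm q_prim l_gt1 xd_family (family_prod_fl_gen q_prim xd_family)).
have comm_tl u : GRing.comm (F ^+ l) u -> GRing.comm (t ^+ l) u.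
  move=> uF; rewrite /GRing.comm -[RHS]mul1r -lF -mulrA (mulrA (F ^+ l)) uF -!mulrA.
  by rewrite Fl mulr1.
by move=> i; have [] := FlC i; split; apply: comm_tl.
Qed.

Lemma tower_powers k : gen_subalg (family_powers l x d) `<=` tower k.
Proof. by apply: gen_subalg_sub => u Gu; apply: mem_gen_subalg; left; left. Qed.

Lemma tower_tl k : (tower k : set A) (t ^+ l).
Proof. by apply: mem_gen_subalg; left; right. Qed.

Lemma tower_xl k i : (tower k : set A) (x i ^+ l).
Proof. by apply: tower_powers; apply: mem_gen_subalg; left; exists i. Qed.

Lemma tower_dl k i : (tower k : set A) (d i ^+ l).
Proof. by apply: tower_powers; apply: mem_gen_subalg; right; exists i. Qed.

Lemma tower_x k (i : 'I_n) : (k <= i)%N -> (tower k : set A) (x i).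
Proof. by move=> ki; apply: mem_gen_subalg; right; exists i; split=> //; left. Qed.

Lemma tower_d k (i : 'I_n) : (k <= i)%N -> (tower k : set A) (d i).
Proof. by move=> ki; apply: mem_gen_subalg; right; exists i; split=> //; right. Qed.

Lemma tower_sub k : tower k.+1 `<=` tower k.
Proof.
apply: gen_subalg_sub => u [Gu|[i [ki ui]]]; apply: mem_gen_subalg; [by left|right].
by exists i; split=> //; apply: ltnW.
Qed.

(** Of the pairs below k only the central l-th powers remain, so coefficients taken in [tower k]
    meet the commutation hypotheses of [pair_indep]. *)
Lemma tower_comm k u (i : 'I_n) : (i < k)%N -> (tower k : set A) u ->
  GRing.comm u (x i) /\ GRing.comm u (d i).
Proof.
move=> ik Lu; suff Gc v : tower_gens k v -> GRing.comm v (x i) /\ GRing.comm v (d i).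
  split; apply/commr_sym; move: u Lu; apply: gen_subalg_comm => v /Gc[vx vd];
  exact/commr_sym.
case=> [[Gv|->]|[j [kj vj]]].
- exact (family_powers_comm q_prim l_gt1 xd_family (mem_gen_subalg Gv) i).
- exact: family_comm_tl.
have ij : i != j by rewrite neq_ltn (leq_trans ik kj).
have ji : j != i by rewrite eq_sym.
case: vj => ->; split.
- exact: family_comm_xx xd_family _ _.
- exact/commr_sym/(family_comm_dx xd_family).
- exact/(family_comm_dx xd_family).
- exact: family_comm_dd xd_family _ _.
Qed.

Hypothesis gen_full :
  forall u, (gen_subalg ([set u | exists i, u = x i \/ u = d i] `|` [set t]) : set A) u.

Lemma tower0 u : (tower 0 : set A) u.
Proof.
move: u (gen_full u); apply: gen_subalg_sub => u [[i ui]|->].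
  by apply: mem_gen_subalg; right; exists i.
(* [F] is a polynomial in the x_i and d_i, so the l-th power of its inverse already gives the
   inverse. *)
have -> : t = t ^+ l * F ^+ l.-1.
  have l_gt0 := prim_order_gt0 q_prim.
  rewrite -{1}(prednK l_gt0) exprS -mulrA -exprMn_comm ?tF ?expr1n ?mulr1 //.
  by rewrite /GRing.comm Ft tF.
apply: subalg_memM; first exact: tower_tl.
apply/subalg_memX/subalg_mem_prod => i.
by apply: subalg_memB; apply: subalg_memM; (exact: tower_x || exact: tower_d).
Qed.

Lemma family_comm_center u : family_comm x d u -> forall v, GRing.comm u v.
Proof.
move=> uC v; move: v (gen_full v); apply: gen_subalg_comm => v.
case=> [[i [->|->]]|->]; try by have [] := uC i.
by apply/family_comm_t/commr_prod => i _; apply: family_comm_fi.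
Qed.

Lemma tower_center u : (tower n : set A) u -> forall v, GRing.comm u v.
Proof. by move=> Lu; apply: family_comm_center => i; apply: tower_comm Lu. Qed.

Section Step.
Variables (k : nat) (kn : (k < n)%N).
Let i := Ordinal kn.
Let e (ab : 'I_l * 'I_l) := x i ^+ ab.1 * d i ^+ ab.2.

Lemma tower_step_indep (c : 'I_l * 'I_l -> A) :
  (forall ab, GRing.comm (c ab) (x i) /\ GRing.comm (c ab) (d i)) ->
  \sum_ab c ab * e ab = 0 -> forall ab, c ab = 0.
Proof.
move=> cC c0.
(* Extension by 0 to natural number indices, the form in which [pair_indep] takes its
   coefficients. *)
pose c' a b := oapp (fun a => oapp (fun b => c (a, b)) 0 (insub b)) 0 (insub a).
have c'E (a b : 'I_l) : c' a b = c (a, b) by rewrite /c' !valK.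
have c'P (P : A -> Prop) : P 0 -> (forall ab, P (c ab)) -> forall a b, P (c' a b).
  by move=> P0 Pc a b; rewrite /c'; case: (insub a) => [a'|] //=; case: (insub b) => [b'|] //=.
case=> a b; rewrite -c'E.
apply: (pair_indep q_prim (family_dx xd_family i) (family_f_unit i)) => //.
- apply: (c'P (fun u => GRing.comm u (x i))) => [|ab]; last by have [] := cC ab.
  exact/commr_sym/commr0.
- apply: (c'P (fun u => GRing.comm u (d i))) => [|ab]; last by have [] := cC ab.
  exact/commr_sym/commr0.
rewrite -[RHS]c0 pair_bigA; apply: eq_bigr => -[a' b'] _ /=.
by rewrite c'E.
Qed.

(** The span [V] contains 1 and absorbs left multiplication by the generators of [tower k]. Those
    lying in [tower k.+1] go into the coefficients, and only x_i and d_i need a computation. *)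
Lemma tower_step_span u : (tower k : set A) u ->
  exists2 c : 'I_l * 'I_l -> A, (forall ab, (tower k.+1 : set A) (c ab)) &
    u = \sum_ab c ab * e ab.
Proof.
move: u; pose V u := exists2 c : 'I_l * 'I_l -> A, (forall ab, (tower k.+1 : set A) (c ab)) &
    u = \sum_ab c ab * e ab.
have VD u v : V u -> V v -> V (u + v).
  move=> [c Lc ->] [c' Lc' ->]; exists (fun ab => c ab + c' ab).
    by move=> ab; apply: subalg_memD.
  by rewrite -big_split; apply: eq_bigr => ab _; rewrite mulrDl.
have VM u v : (tower k.+1 : set A) u -> V v -> V (u * v).
  move=> Lu [c Lc ->]; exists (fun ab => u * c ab).
    by move=> ab; apply: subalg_memM.
  by rewrite mulr_sumr; apply: eq_bigr => ab _; rewrite mulrA.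
have VZ (c : K) u : V u -> V (c *: u).
  by move=> Vu; rewrite -alg_const_mul; apply: VM => //; case: (subalgP (tower k.+1)).
have l_gt0 := prim_order_gt0 q_prim.
(* Exponents are divided by l; the l-th powers belong to [tower k.+1]. *)
have Ve a b : V (x i ^+ a * d i ^+ b).
  have -> : x i ^+ a * d i ^+ b = (x i ^+ l) ^+ (a %/ l) * (d i ^+ l) ^+ (b %/ l)
      * (x i ^+ (a %% l) * d i ^+ (b %% l)).
    rewrite {1}(divn_eq a l) {1}(divn_eq b l) !exprD ![(_ * l)%N]mulnC !exprM.
    rewrite -!mulrA; congr (_ * _); rewrite !mulrA; congr (_ * _).
    apply/commr_sym/commrX.
    apply/commr_sym/commrX/commr_sym.
    by have [] := family_comm_dl q_prim l_gt1 xd_family i i.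
  apply: VM.
    by apply: subalg_memM; apply: subalg_memX; [apply: tower_xl|apply: tower_dl].
  pose ab0 := (Ordinal (ltn_pmod a l_gt0), Ordinal (ltn_pmod b l_gt0)).
  exists (fun ab => (ab == ab0)%:R).
    by move=> ab; case: (ab == ab0); [apply: subalg_mem1|apply: subalg_mem0].
  rewrite (bigD1 ab0) //= eqxx mul1r big1 ?addr0 // => ab /negPf->.
  by rewrite mul0r.
have Vsum (c : 'I_l * 'I_l -> A) v : (forall ab, (tower k.+1 : set A) (c ab)) ->
    (forall ab, GRing.comm v (c ab)) ->
    (forall ab, V (v * e ab)) -> V (v * \sum_ab c ab * e ab).
  move=> Lc vc Vv; rewrite mulr_sumr; apply: big_ind => // [|ab _].
    by exists (fun=> 0); [move=> _; apply: subalg_mem0|rewrite big1 // => ab _; rewrite mul0r].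
  by rewrite mulrA vc -mulrA; apply: VM.
apply: gen_subalg_lmul => // [u v Gu Vv|]; last by have := Ve 0 0; rewrite mulr1.
have Lxd (c : A) : (tower k.+1 : set A) c -> GRing.comm c (x i) /\ GRing.comm c (d i).
  exact: tower_comm.
case: Gu => [Gu|[j [kj uj]]]; first by apply: VM => //; apply: mem_gen_subalg; left.
have [jk|jk] := ltnP k j.
  by apply: VM => //; apply: mem_gen_subalg; right; exists j.
have ji : j = i by apply/val_inj/eqP; rewrite /= eqn_leq jk kj.
case: Vv => c Lc ->; case: uj => ->; rewrite ji; apply: Vsum => // [ab|[a b]].
- by apply/commr_sym; have [] := Lxd _ (Lc ab).
- by rewrite mulrA -exprS.
- by apply/commr_sym; have [] := Lxd _ (Lc ab).
rewrite /e /= mulrA; case: a => -[|a] al /=.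
  by rewrite mulr1 -exprS -[_ ^+ _]mul1r; apply: (Ve 0).
(* Normal ordering of d x^(a+1); the second coefficient is the q-integer (q^(a+1) - 1)/(q - 1). *)
have -> : d i * x i ^+ a.+1 = q ^+ a.+1 *: (x i ^+ a.+1 * d i)
    + ((q - 1)^-1 * (q ^+ a.+1 - 1)) *: x i ^+ a.
  apply: (q1I q_prim l_gt1); rewrite (pair_dxS (family_dx xd_family i)).
  rewrite (pair_f (family_dx xd_family i)) scalerDr scalerA mulrBr mulr1.
  rewrite mulrDr [in RHS]scalerDr !scalerA mulVKf ?(q1_neq0 q_prim l_gt1) //.
  rewrite -!pzscalerAr mulr1 mulrA -exprSr scalerBl scale1r addrA.
  by rewrite [_ * (q - 1)]mulrC.
by rewrite mulrDl -!pzscalerAl -mulrA -exprS; apply: VD; apply: VZ; apply: Ve.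
Qed.

Lemma tower_free : free_on (tower k) (tower k.+1) e.
Proof.
split; first exact: tower_step_span.
- move=> c Lc; apply: tower_step_indep => ab; exact: tower_comm (Lc ab).
- move=> ab; apply: subalg_memM; apply: subalg_memX; (exact: tower_x || exact: tower_d).
Qed.

(** As u itself commutes with x_i and d_i, the trivial expression u = u x^0 d^0 has coefficients to
    which independence applies. Comparing it with the expansion over [tower k.+1] identifies u with
    the coefficient at (0, 0). *)
Lemma tower_centralizer u : (tower k : set A) u ->
  GRing.comm u (x i) -> GRing.comm u (d i) -> (tower k.+1 : set A) u.
Proof.
move=> Lu ux ud; have [c Lc uE] := tower_step_span Lu.
have l_gt0 := prim_order_gt0 q_prim; pose o := Ordinal l_gt0.
pose c' ab := c ab - (if ab == (o, o) then u else 0).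
suff /(_ (o, o)) : forall ab, c' ab = 0.
  by rewrite /c' eqxx => /subr0_eq <-.
apply: tower_step_indep => [ab|].
  have [cx cd] := tower_comm (ltnSn k : (i < k.+1)%N) (Lc ab).
  by split; apply/commr_sym/commrB; try exact/commr_sym; case: ifP => _;
    try exact/commr_sym; apply: commr0.
under eq_bigr do rewrite mulrBl.
rewrite sumrB -uE (bigD1 (o, o)) //= ?eqxx big1 ?addr0 => [|ab /negPf->].
  by rewrite /e !mulr1 subrr.
by rewrite mul0r.
Qed.

End Step.

Lemma tower_basis k : (k <= n)%N -> exists (I : finType) (e : I -> A),
  #|I| = ((l * l) ^ k)%N /\ free_on (tower 0) (tower k) e.
Proof.
elim: k => [_|k IHk kn].
  exists 'I_1, (fun=> 1); rewrite card_ord; split=> //; split.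
  - by move=> u Lu; exists (fun=> u) => //; rewrite big_ord1 mulr1.
  - by move=> c _; rewrite big_ord1 mulr1 => c0 i; rewrite ord1.
  - by move=> _; apply: subalg_mem1.
have [I [e [cardI eF]]] := IHk (ltnW kn).
exists (I * ('I_l * 'I_l))%type; eexists; split.
  by rewrite !card_prod !card_ord cardI expnSr.
apply: free_on_trans eF (tower_free kn); last exact: tower_sub.
by move=> u _; apply: tower0.
Qed.

Lemma centerE : (center A : set A) = tower n.
Proof.
apply/seteqP; split=> u; last by move=> /tower_center.
move=> uC; suff : forall k, (k <= n)%N -> (tower k : set A) u by apply.
elim=> [_|k IHk kn]; first exact: tower0.
exact (@tower_centralizer k kn u (IHk (ltnW kn)) (uC _) (uC _)).
Qed.

End LocalizedFamily.

(** * Uniqueness of localizations of a commutative algebra *)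

Section LocalizationUnique.
Variable K : comNzRingType.

(** Says that [b1] and [b2] are the same fraction s^-1 a. Fractions have many representatives, so
    the isomorphism is built as a relation compatible with the operations; single-valuedness then
    only has to be checked at 0. *)
Definition loc_graph (Z B1 B2 : pzAlgType K) (S : set Z)
    (phi1 : {rmorphism Z -> B1}) (phi2 : {rmorphism Z -> B2}) (b1 : B1) (b2 : B2) :=
  exists s a, [/\ S s, phi1 s * b1 = phi1 a & phi2 s * b2 = phi2 a].

Variables (Z : pzAlgType K) (S : set Z).
Hypotheses (ZC : forall u v : Z, u * v = v * u) (S1 : S 1).
Hypothesis (SM : forall u v, S u -> S v -> S (u * v)).

Lemma loc_comm (B : pzAlgType K) (phi : {rmorphism Z -> B}) :
  is_ore_localization S phi -> forall z b, phi z * b = b * phi z.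
Proof.
move=> [_ Sinv Sfrac _] z b; have [s [a [Ss sb]]] := Sfrac b.
have [t ts st] := Sinv s Ss.
rewrite -[LHS]mul1r -ts -mulrA [phi s * _]mulrA -rmorphM ZC rmorphM -mulrA sb.
by rewrite -rmorphM ZC rmorphM -sb !mulrA ts mul1r.
Qed.

Section Graph.
Variables (B1 B2 : pzAlgType K).
Variables (phi1 : {rmorphism Z -> B1}) (phi2 : {rmorphism Z -> B2}).
Hypotheses (loc1 : is_ore_localization S phi1) (loc2 : is_ore_localization S phi2).
Local Notation R := (loc_graph S phi1 phi2).

Lemma loc_graph_total b1 : exists b2, R b1 b2.
Proof.
case: loc1 loc2 => _ _ /(_ b1)[s [a [Ss sa]]] _ [_ /(_ s Ss)[t ts st] _ _].
by exists (t * phi2 a), s, a; split=> //; rewrite mulrA st mul1r.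
Qed.

Lemma loc_graphB b1 b1' b2 b2' : R b1 b2 -> R b1' b2' -> R (b1 - b1') (b2 - b2').
Proof.
move=> [s [a [Ss sb1 sb2]]] [s' [a' [Ss' sb1' sb2']]].
exists (s * s'), (s' * a - s * a'); split; first exact: SM.
  rewrite rmorphB mulrBr; congr (_ - _); last by rewrite !rmorphM -mulrA sb1'.
  by rewrite ZC !rmorphM -mulrA sb1.
rewrite rmorphB mulrBr; congr (_ - _); last by rewrite !rmorphM -mulrA sb2'.
by rewrite ZC !rmorphM -mulrA sb2.
Qed.

Lemma loc_graphM b1 b1' b2 b2' : R b1 b2 -> R b1' b2' -> R (b1 * b1') (b2 * b2').
Proof.
move=> [s [a [Ss sb1 sb2]]] [s' [a' [Ss' sb1' sb2']]].
exists (s * s'), (a * a'); split; first exact: SM.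
  by rewrite !rmorphM -mulrA [phi1 s' * _]mulrA (loc_comm loc1 s') !mulrA sb1 -mulrA sb1'.
by rewrite !rmorphM -mulrA [phi2 s' * _]mulrA (loc_comm loc2 s') !mulrA sb2 -mulrA sb2'.
Qed.

Lemma loc_graph_phi z : R (phi1 z) (phi2 z).
Proof. by exists 1, z; rewrite !rmorph1 !mul1r. Qed.

(** Both kernels are the [S]-torsion of [Z], so a numerator killed by [phi1] is killed by [phi2]. *)
Lemma loc_graph0 b2 : R 0 b2 -> b2 = 0.
Proof.
case: loc1 loc2 => _ _ _ ker1 [_ Sinv _ ker2] [s [a [Ss]]].
rewrite mulr0 => /esym/ker1/ker2 -> sb2; have [t ts _] := Sinv s Ss.
by rewrite -[LHS]mul1r -ts -mulrA sb2 mulr0.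
Qed.

Lemma loc_graph_fun b1 b2 b2' : R b1 b2 -> R b1 b2' -> b2 = b2'.
Proof.
by move=> R2 R2'; apply/subr0_eq/loc_graph0; rewrite -(subrr b1); apply: loc_graphB.
Qed.

End Graph.

Lemma loc_graph_sym (B1 B2 : pzAlgType K) (phi1 : {rmorphism Z -> B1})
  (phi2 : {rmorphism Z -> B2}) b1 b2 :
  loc_graph S phi1 phi2 b1 b2 -> loc_graph S phi2 phi1 b2 b1.
Proof. by move=> [s [a [Ss sb1 sb2]]]; exists s, a. Qed.

Lemma localization_isom (B1 B2 : pzAlgType K)
    (phi1 : {rmorphism Z -> B1}) (phi2 : {rmorphism Z -> B2}) :
  is_ore_localization S phi1 -> is_ore_localization S phi2 -> alg_isom B1 B2.
Proof.
move=> loc1 loc2.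
have [f fR] := choice (loc_graph_total loc1 loc2).
have [g gR] := choice (loc_graph_total loc2 loc1).
have fE b1 b2 : loc_graph S phi1 phi2 b1 b2 -> f b1 = b2.
  exact (loc_graph_fun loc1 loc2 (fR b1)).
have fB : zmod_morphism f by move=> u v; apply/fE/loc_graphB.
have fM : GRing.monoid_morphism f.
  split; last by move=> u v; apply/fE/(loc_graphM loc1 loc2).
  by rewrite -(rmorph1 phi1) -(rmorph1 phi2); apply/fE/loc_graph_phi.
pose f' : {rmorphism B1 -> B2} := HB.pack_for {rmorphism B1 -> B2} f
  (GRing.isZmodMorphism.Build _ _ f fB) (GRing.isMonoidMorphism.Build _ _ f fM).
exists f'.
  move=> c; rewrite /f' /=; case: (loc1) (loc2) => h1 _ _ _ [h2 _ _ _].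
  by rewrite -h1 -h2; apply/fE/loc_graph_phi.
exists g => b.
  exact (loc_graph_fun loc2 loc1 (gR _) (loc_graph_sym (fR b))).
exact/fE/loc_graph_sym.
Qed.

End LocalizationUnique.

(** * Generators and relations of the quantum Weyl algebra *)

Lemma alg_hom_qcomm (K : comNzRingType) (A B : pzAlgType K) (f : {rmorphism A -> B})
    (c : K) (u v : A) (m : nat) : alg_hom f ->
  f (u * v - alg_const c * (v * u) - m%:R) = 0 ->
  f u * f v = c *: (f v * f u) + m%:R.
Proof.
move=> fC; rewrite !rmorphB !rmorphM rmorph_nat fC alg_const_mul => /subr0_eq/eqP.
by rewrite subr_eq addrC => /eqP.
Qed.

Lemma alg_hom_comm (K : comNzRingType) (A B : pzAlgType K) (f : {rmorphism A -> B})
    (u v : A) : f (u * v - v * u) = 0 -> f u * f v = f v * f u.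
Proof. by rewrite !rmorphB !rmorphM => /subr0_eq. Qed.

Section WeylFamily.
Variables (K : fieldType) (n : nat) (q : K).

Lemma weyl_pi_rel r : weyl_relations q r -> weyl_pi n q r = 0.
Proof.
move=> Rr; rewrite -(rmorph0 (weyl_pi n q)); apply/quot_piP.
by rewrite subr0; apply: sub_gen_smallest.
Qed.

Lemma weyl_pi_alg_hom : alg_hom (weyl_pi n q).
Proof. by []. Qed.

Lemma weyl_family : @qweyl_family K n q (qweyl n q) (@weyl_x K n q) (@weyl_d K n q).
Proof.
split=> i j.
- apply: (alg_hom_qcomm weyl_pi_alg_hom); apply: weyl_pi_rel.
  by exists i, j; apply: Or31.
- apply: alg_hom_comm; apply: weyl_pi_rel.
  by exists i, j; apply: Or32.
- apply: alg_hom_comm; apply: weyl_pi_rel.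
  by exists i, j; apply: Or33.
Qed.

(** Monomials of the free algebra are words, and a word is the product of its letters. *)
Lemma weyl_generated u :
  (gen_subalg [set u : qweyl n q | exists i, u = weyl_x q i \/ u = weyl_d q i] : set _) u.
Proof.
set G := gen_subalg _.
have G_word (s : seq ('I_n + 'I_n)) : (G : set _) (weyl_pi n q (mkmalgU (FMonom s) 1)).
  elim: s => [|i s IHs].
    have -> : mkmalgU (FMonom [::]) 1 = 1 :> free_alg K n by rewrite -fmoneE.
    by rewrite rmorph1; apply: subalg_mem1.
  have -> : mkmalgU (FMonom (i :: s)) 1
      = mkmalgU (fmu i) 1 * mkmalgU (FMonom s) 1 :> free_alg K n.
    rewrite malgM_def fgmulUU mulr1 fmuE. congr mkmalgU.
    exact (esym (fmmulE (FMonom [:: i]) (FMonom s))).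
  rewrite rmorphM; apply: subalg_memM => //; apply: mem_gen_subalg.
  by case: i => i; exists i; [left|right].
rewrite -[u]quot_reprK; move: (quot_repr u) => {u} w.
rewrite (monalgE w) (raddf_sum (weyl_pi n q)); apply: big_ind => [|v1 v2|k _].
- exact: subalg_mem0.
- exact: subalg_memD.
have -> : mkmalgU k (mcoeff k w) 
    = (alg_const (mcoeff k w) : free_alg K n) * (mkmalgU k 1 : free_alg K n).
  by rewrite malgM_def fgmulUU mulr1 mul1m.
have Gk : (G : set _)
    (weyl_pi n q ((alg_const (mcoeff k w) : free_alg K n) * (mkmalgU k 1 : free_alg K n))).
  by rewrite rmorphM weyl_pi_alg_hom alg_const_mul -[k]fmK; apply: subalgZ.
exact Gk.
Qed.

End WeylFamily.

(** * Center of the Ore localization *)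

Section OreFamily.
Variables (K : fieldType) (l n : nat) (q : K).
Hypotheses (q_prim : l.-primitive_root q) (l_gt1 : (1 < l)%N).
Variables (A : pzAlgType K) (x d : 'I_n -> A).
Hypothesis xd_family : qweyl_family q x d.
Hypothesis xd_gen :
  forall u, (gen_subalg [set u | exists i, u = x i \/ u = d i] : set A) u.
Local Notation f := (\prod_(i < n) family_f x d i).
Variables (B : pzAlgType K) (phi : {rmorphism A -> B}).
Hypothesis phi_loc : is_ore_localization (powers f) phi.
Local Notation X := (fun i => phi (x i)).
Local Notation D := (fun i => phi (d i)).

Lemma ore_family : qweyl_family q X D.
Proof.
by case: phi_loc => phiC _ _ _; apply: alg_hom_family.
Qed.

Lemma ore_family_f : phi f = \prod_(i < n) family_f X D i.
Proof. exact: rmorph_family_prod. Qed.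

Local Notation F := (\prod_(i < n) family_f X D i).

Lemma ore_family_inv : exists t, [/\ F * t = 1, t * F = 1 &
  forall u, (gen_subalg ([set u | exists i, u = X i \/ u = D i] `|` [set t]) : set B) u].
Proof.
rewrite -ore_family_f; case: phi_loc => phiC Sinv frac _.
have [|t tf ft] := Sinv f; first by exists 1%N.
exists t; split=> // b; set G := gen_subalg _.
have Gphi u : (G : set B) (phi u).
  move: (phi u) (gen_subalg_image phiC (xd_gen u)); apply: gen_subalg_sub.
  move=> _ [v [i vi] <-]; apply: mem_gen_subalg; left; exists i.
  by case: vi => ->; [left|right].
have [s [a [[k _ <-] sb]]] := frac b.
have -> : b = t ^+ k * phi a.
  by rewrite -sb rmorphXn mulrA -exprMn_comm ?tf ?expr1n ?mul1r // /GRing.comm tf ft.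
apply: subalg_memM => //; apply: subalg_memX.
by apply: mem_gen_subalg; right.
Qed.

Local Notation Z := (gen_subalg (family_powers l x d)).

Lemma ore_center_subproof (z : subalg_type Z) : phi (val z) \in subalg_pred (center B).
Proof.
apply/subalg_predP; have [t [Ft tF gen]] := ore_family_inv.
apply: (family_comm_center Ft tF gen) => i.
have /subalg_predP/(family_powers_comm q_prim l_gt1 xd_family)/(_ i)[zx zd] := subalg_valP z.
by split; rewrite /GRing.comm -!rmorphM ?zx ?zd.
Qed.

Definition ore_center_map (z : subalg_type Z) : subalg_type (center B) :=
  SubalgElt (ore_center_subproof z).
Fact ore_center_map_zmod : zmod_morphism ore_center_map.
Proof. by move=> u v; apply: val_inj; rewrite /= !rmorphB. Qed.
Fact ore_center_map_monoid : GRing.monoid_morphism ore_center_map.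
Proof. by split=> [|u v]; apply: val_inj; rewrite /= ?rmorph1 ?rmorphM. Qed.
HB.instance Definition _ := GRing.isZmodMorphism.Build (subalg_type Z)
  (subalg_type (center B)) ore_center_map ore_center_map_zmod.
HB.instance Definition _ := GRing.isMonoidMorphism.Build (subalg_type Z)
  (subalg_type (center B)) ore_center_map ore_center_map_monoid.

Lemma ore_fl_gen : (Z : set A) (f ^+ l).
Proof. exact (family_prod_fl_gen q_prim xd_family). Qed.

(** Clearing denominators directly would only give a numerator in [A]. By [centerE] the center is
    generated by images of elements of [Z] together with [t ^+ l], and only the latter needs a
    denominator, namely [f ^+ l]. *)
Lemma ore_center_frac b : (center B : set B) b ->
  exists k z, (Z : set A) z /\ phi ((f ^+ l) ^+ k) * b = phi z.
Proof.
case: (phi_loc) => phiC _ _ _.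
have [t [Ft tF gen]] := ore_family_inv.
rewrite (centerE q_prim l_gt1 ore_family Ft tF gen).
have phiZ z b' : (Z : set A) z -> phi z * b' = b' * phi z.
  move=> Zz; have /subalg_predP zC := ore_center_subproof (SubalgElt (asboolT Zz)).
  exact (zC b').
have fZ k : (Z : set A) ((f ^+ l) ^+ k) by apply: subalg_memX; apply: ore_fl_gen.
elim/gen_subalg_ind: b / => [u [[Gu| ->]|[i [ni _]]]|c|u v|u v].
- have [z Zz ->] : exists2 z, (Z : set A) z & u = phi z.
    case: Gu => -[i _ <-].
      exists (x i ^+ l); last by rewrite rmorphXn.
      by apply: mem_gen_subalg; left; exists i.
    exists (d i ^+ l); last by rewrite rmorphXn.
    by apply: mem_gen_subalg; right; exists i.
  by exists 0%N, z; rewrite rmorph1 mul1r.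
- exists 1%N, 1; split; first exact: subalg_mem1.
  by rewrite expr1 rmorphXn ore_family_f -exprMn_comm ?Ft ?expr1n ?rmorph1 // /GRing.comm Ft tF.
- by move: ni; rewrite leqNgt ltn_ord.
- exists 0%N, (c *: (1 : A)); split; first exact/subalgZ/subalg_mem1.
  by rewrite (alg_homZ _ _ phiC) !rmorph1 mul1r.
- move=> [k [z [Zz uz]]] [k' [z' [Zz' vz']]].
  exists (k + k')%N, ((f ^+ l) ^+ k' * z + (f ^+ l) ^+ k * z'); split.
    by apply: subalg_memD; apply: subalg_memM.
  rewrite mulrDr !rmorphD !rmorphM -uz -vz' !mulrA -!rmorphM -!exprD.
  by rewrite [(k' + k)%N]addnC.
- move=> [k [z [Zz uz]]] [k' [z' [Zz' vz']]].
  exists (k + k')%N, (z * z'); split; first exact: subalg_memM.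
  by rewrite exprD !rmorphM -mulrA [phi _ * (u * v)]mulrA (phiZ _ u (fZ k')) !mulrA uz -mulrA vz'.
Qed.

Lemma ore_center_loc : is_ore_localization
  [set z : subalg_type Z | powers (f ^+ l) (val z)] ore_center_map.
Proof.
have [t [Ft tF gen]] := ore_family_inv.
case: (phi_loc) => phiC _ _ phi_ker.
have fZ k : (f ^+ l) ^+ k \in subalg_pred Z.
  by apply/subalg_predP; apply: subalg_memX; apply: ore_fl_gen.
split.
- by move=> c; apply: val_inj; rewrite /= phiC.
- move=> s [k _ sk].
  have tlC : (t ^+ l) ^+ k \in subalg_pred (center B).
    apply/subalg_predP/subalg_memX; rewrite (centerE q_prim l_gt1 ore_family Ft tF gen).
    exact: tower_tl.
  exists (SubalgElt tlC); apply: val_inj; rewrite /= -sk !rmorphXn ore_family_f -!exprM;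
    by rewrite -exprMn_comm ?tF ?Ft ?expr1n // /GRing.comm Ft tF.
- move=> b; have /subalg_predP/ore_center_frac[k [z [Zz bz]]] := subalg_valP b.
  exists (SubalgElt (fZ k)), (SubalgElt (asboolT Zz)); split; first by exists k.
  exact: val_inj.
- move=> z; split=> [/(congr1 val) /= /phi_ker[_ [k _ <-]] fz|[s [k _ sk] sz]].
    exists (SubalgElt (fZ k)); first by exists k.
    apply: val_inj; rewrite /= -exprM.
    (* The power of f killing z is enlarged to a power of f^l. *)
    have -> : (l * k = l.-1 * k + k)%N.
      by rewrite -[in LHS](prednK (prim_order_gt0 q_prim)) mulSn addnC.
    by rewrite exprD -mulrA fz mulr0.
  apply: val_inj; rewrite /=; apply/phi_ker; exists ((f ^+ l) ^+ k).
    by exists (l * k)%N; rewrite ?exprM.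
  by rewrite sk -[RHS](congr1 val sz).
Qed.

Lemma ore_center_isom (Zf : pzAlgType K) (psi : {rmorphism subalg_type Z -> Zf}) :
  is_ore_localization [set z : subalg_type Z | powers (f ^+ l) (val z)] psi ->
  alg_isom (subalg_type (center B)) Zf.
Proof.
apply: localization_isom ore_center_loc => [u v||u v [k _ uk] [k' _ vk']].
- apply: val_inj => /=.
  have /subalg_predP Zu := subalg_valP u; have /subalg_predP Zv := subalg_valP v.
  have Zxd := family_powers_comm q_prim l_gt1 xd_family Zu.
  by move: (val v) Zv; apply: gen_subalg_comm => _ [][i _ <-]; apply: commrX; have [] := Zxd i.
- by exists 0%N.
- by exists (k + k')%N => //; rewrite exprD uk vk'.
Qed.

End OreFamily.

(** * Spans of words, and maximal ideals of commutative algebras *)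

Section MaximalIdeals.
Variables (K : comNzRingType) (A : pzAlgType K).

Section Span.
Implicit Types (X Y : seq A) (u v : A).

Definition in_span X u := exists c : nat -> K, u = \sum_(i < size X) c i *: X`_i.

Lemma in_spanD X u v : in_span X u -> in_span X v -> in_span X (u + v).
Proof.
move=> [c ->] [c' ->]; exists (fun i => c i + c' i).
by rewrite -big_split; apply: eq_bigr => i _; rewrite scalerDl.
Qed.

Lemma in_spanZ X c u : in_span X u -> in_span X (c *: u).
Proof.
move=> [c' ->]; exists (fun i => c * c' i).
by rewrite scaler_sumr; apply: eq_bigr => i _; rewrite scalerA.
Qed.

Lemma in_span_mem X u : u \in X -> in_span X u.
Proof.
move=> uX; exists (fun i => (i == index u X)%:R).
have iX : (index u X < size X)%N by rewrite index_mem.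
rewrite (bigD1 (Ordinal iX)) //= eqxx scale1r nth_index // big1 ?addr0 // => i.
by rewrite -val_eqE /= => /negPf->; rewrite scale0r.
Qed.

Lemma in_span_sub (P : A -> Prop) X u : P 0 -> (forall u v, P u -> P v -> P (u + v)) ->
  (forall (c : K) u, P u -> P (c *: u)) -> (forall u, u \in X -> P u) -> in_span X u -> P u.
Proof.
move=> P0 PD PZ PX [c ->]; apply: big_ind => // i _.
by apply/PZ/PX/mem_nth.
Qed.

Lemma in_span0 X : in_span X 0.
Proof. by exists (fun=> 0); rewrite big1 // => i _; rewrite scale0r. Qed.

Variable s : seq A.
Fixpoint words k : seq A :=
  if k is k'.+1 then words k' ++ [seq g * w | g <- s, w <- words k'] else [:: 1].

Lemma in_span_words_le j k u : (j <= k)%N -> in_span (words j) u -> in_span (words k) u.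
Proof.
move=> /subnK <-; elim: (k - j)%N u => [//|i IHi] u ju.
apply: in_span_sub (IHi u ju); [exact: in_span0|exact: in_spanD|exact: in_spanZ|].
by move=> v vi; apply: in_span_mem; rewrite addSn /= mem_cat vi.
Qed.

(** Presents a finitely generated algebra as a countable increasing union of finitely spanned
    subspaces, the form in which the Nullstellensatz uses finite generation. *)
Lemma gen_in_span u : (gen_subalg [set` s] : set A) u -> exists k, in_span (words k) u.
Proof.
move: u; apply: gen_subalg_lmul => [u v [j ju] [k kv]|c u [k ku]|g u gs [k ku]|].
- exists (maxn j k); apply: in_spanD.
    by apply: in_span_words_le ju; apply: leq_maxl.
  by apply: in_span_words_le kv; apply: leq_maxr.
- by exists k; apply: in_spanZ.
- exists k.+1; apply: (in_span_sub (P := fun u => in_span (words k.+1) (g * u))) ku.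
  + by rewrite mulr0; apply: in_span0.
  + by move=> v w; rewrite mulrDr; apply: in_spanD.
  + by move=> c v; rewrite -pzscalerAr; apply: in_spanZ.
  + move=> w wk; apply: in_span_mem; rewrite /= mem_cat; apply/orP; right.
    exact: allpairs_f.
- by exists 0%N; apply: in_span_mem; rewrite inE.
Qed.

End Span.

Hypothesis AC : forall u v : A, u * v = v * u.
Variable m : set A.
Hypothesis m_max : maximal_ideal m.

Lemma maximal_ideal_n1 : ~ m 1.
Proof.
case: m_max => -[_ _ mM _] mT _ m1; apply: mT.
by apply/seteqP; split=> // u _; rewrite -[u]mulr1; apply: mM.
Qed.

Lemma ideal_memZ (c : K) u : m u -> m (c *: u).
Proof. by case: m_max => -[_ _ mM _] _ _ mu; rewrite -alg_const_mul; apply: mM. Qed.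

Lemma ideal_memB u v : m u -> m v -> m (u - v).
Proof.
by case: m_max => -[_ mD _ _] _ _ mu mv; rewrite -scaleN1r; apply/mD/ideal_memZ.
Qed.

(** Maximality is applied to [J], which is the ideal m + (u). *)
Lemma maximal_ideal_inv u : ~ m u -> exists w, m (u * w - 1).
Proof.
move=> nmu; have [[m0 mD mMl mMr] _ mM] := m_max.
pose J := [set v | exists w, m (v - u * w)].
have JI : twosided_ideal J.
  have Jl a v : J v -> J (a * v).
    move=> [w mw]; exists (a * w).
    by rewrite mulrA (AC u) -mulrA -mulrBr; apply: mMl.
  split=> [|v v' [w mw] [w' mw']|//|a v Jv]; last by rewrite -AC; apply: Jl.
    by exists 0; rewrite mulr0 subrr.
  by exists (w + w'); rewrite mulrDr opprD addrACA; apply: mD.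
have mJ : m `<=` J by move=> v mv; exists 0; rewrite mulr0 subr0.
case: (mM J JI mJ) => [Jm|JT].
  by case: nmu; rewrite -Jm; exists 1; rewrite mulr1 subrr.
have : J 1 by rewrite JT.
by move=> [w mw]; exists w; rewrite -opprB -scaleN1r; apply: ideal_memZ.
Qed.

Lemma maximal_ideal_prime u v : m (u * v) -> m u \/ m v.
Proof.
have [[m0 mD mMl mMr] _ _] := m_max.
move=> muv; have [mu|nmu] := pselect (m u); [by left|right].
have [w mw] := maximal_ideal_inv nmu.
have -> : v = w * (u * v) - v * (u * w - 1).
  by rewrite mulrBr mulr1 (AC u w) (AC v) !mulrA opprB addrC subrK.
by apply: ideal_memB; apply: mMl.
Qed.

End MaximalIdeals.

(** * The Nullstellensatz over an uncountable algebraically closed field *)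

Section Nullstellensatz.
Variables (K : closedFieldType) (A : pzAlgType K).
Hypothesis K_uncountable : forall D : nat -> seq K, exists c, forall k, c \notin D k.
Hypothesis AC : forall u v : A, u * v = v * u.
Variable m : set A.
Hypothesis m_max : maximal_ideal m.

(** The polynomial splits, and m is prime, so some linear factor evaluates into m. *)
Lemma maximal_ideal_root z p : p != 0 -> m (alg_eval z p) -> exists c : K, m (z - alg_const c).
Proof.
move=> p0; have [r pE] := closed_field_poly_normal p.
rewrite pE alg_evalZ => /(ideal_memZ m_max (lead_coef p)^-1).
rewrite scalerA mulVf ?lead_coef_eq0 // scale1r {p0 pE}.
elim: r => [|c r IHr]; rewrite ?big_nil ?big_cons.
  by rewrite alg_eval1 => /(maximal_ideal_n1 m_max).
rewrite alg_evalM => /(maximal_ideal_prime AC m_max)[|/IHr//].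
by rewrite alg_evalB alg_evalX alg_evalC -alg_constE; exists c.
Qed.

(* The inverses of z - c for distinct c are linearly independent modulo m unless z is
   algebraic modulo m. *)
Lemma maximal_ideal_dependent z X (s : seq K) (w : K -> A) : uniq s ->
  (size X < size s)%N ->
  (forall c, c \in s -> in_span X (w c) /\ m ((z - alg_const c) * w c - 1)) ->
  exists c : K, m (z - alg_const c).
Proof.
have [[m0 mD mMl mMr] _ _] := m_max.
move=> s_uniq Xs sw; pose c (i : 'I_(size s)) := s`_i.
have cs i : c i \in s by apply: mem_nth.
have /choice[k kE] : forall i : 'I_(size s), exists k : nat -> K,
    w (c i) = \sum_(j < size X) k j *: X`_j by move=> i; have [] := sw _ (cs i).
(* More rows than columns: a nonzero row in the kernel is a linear dependence among the inverses
   [w (c i)]. *)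
pose M := \matrix_(i < size s, j < size X) k i j.
have : kermx M != 0.
  rewrite kermx_eq0 /row_free; apply: contraTneq Xs => rM.
  by rewrite -leqNgt -rM rank_leq_col.
move=> /rowV0Pn[v /sub_kermxP vM v0].
have vw : \sum_i v 0 i *: w (c i) = 0.
  under eq_bigr do rewrite kE scaler_sumr.
  rewrite exchange_big /=; apply: big1 => j _.
  under eq_bigr do rewrite scalerA.
  rewrite -scaler_suml.
  have := congr1 (fun N : 'rV_(size X) => N 0 j) vM; rewrite !mxE.
  by under eq_bigr do rewrite mxE; move=> ->; rewrite scale0r.
pose P i := \prod_(j | j != i) ('X - (c j)%:P).
pose Q := \prod_i ('X - (c i)%:P).
have PQ i : P i * ('X - (c i)%:P) = Q by rewrite /Q (bigD1 i) //= mulrC.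
(* The numerator left after clearing denominators in the sum of the v_i / (z - c_i). It is nonzero
   because p(c_i) = v_i P_i(c_i). *)
pose p := \sum_i v 0 i *: P i.
have [i vi] : exists i, v 0 i != 0 by apply/rV0Pn.
have p0 : p != 0.
  apply/eqP => /(congr1 (horner^~ (c i))); rewrite hornerE horner_sum (bigD1 i) //=.
  rewrite [X in _ + X]big1 ?addr0 => [|j ji].
    rewrite hornerZ => /eqP; rewrite mulf_eq0 (negPf vi) /= horner_prod.
    apply/negP/prodf_neq0 => j ji; rewrite hornerXsubC subr_eq0 /c nth_uniq //.
    by rewrite eq_sym.
  rewrite hornerZ horner_prod (bigD1 i) 1?eq_sym //= hornerXsubC subrr mul0r.
  by rewrite mulr0.
apply: (maximal_ideal_root p0).
(* The subtracted terms add up to Q(z) times the vanishing combination of the inverses; afterwards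
   each term is P_i(z) (1 - (z - c_i) w(c_i)), an element of m. *)
have -> : alg_eval z p = \sum_i v 0 i *: (alg_eval z (P i) - alg_eval z Q * w (c i)).
  under [RHS]eq_bigr do rewrite scalerBr.
  rewrite sumrB -[X in _ - X](_ : 0 = _); last first.
    by under eq_bigr do rewrite pzscalerAr; rewrite -mulr_sumr vw mulr0.
  rewrite subr0 /p (big_morph (alg_eval z) (alg_evalD z) (alg_eval0 z)).
  by apply: eq_bigr => j _; rewrite alg_evalZ.
apply: big_ind => // j _; apply: (ideal_memZ m_max).
have [_ mw] := sw _ (cs j).
rewrite -(PQ j) alg_evalM alg_evalB alg_evalX alg_evalC -alg_constE.
rewrite -[X in X - _]mulr1 -mulrA -mulrBr; apply: mMl.
by rewrite -opprB -scaleN1r; apply: (ideal_memZ m_max).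
Qed.

(** A duplicate-free list of maximal length inside [P] exhausts [P]. *)
Lemma bounded_seq (P : K -> Prop) N :
  (forall s : seq K, uniq s -> (forall c, c \in s -> P c) -> (size s <= N)%N) ->
  exists s : seq K, forall c, P c -> c \in s.
Proof.
elim: N => [|N IHN] PN.
  exists [::] => c Pc; have := PN [:: c] isT; rewrite ltnn; apply.
  by move=> c'; rewrite inE => /eqP->.
have [[s [s_uniq sP sN]]|ns] := pselect (exists s : seq K,
    [/\ uniq s, forall c, c \in s -> P c & size s = N.+1]).
  exists s => c Pc; apply/negPn/negP => cs.
  have csP c' : c' \in c :: s -> P c' by rewrite inE => /orP[/eqP->|/sP].
  by have := PN (c :: s); rewrite /= cs s_uniq sN ltnn => /(_ isT csP).
apply: IHN => s s_uniq sP; rewrite -ltnS ltn_neqAle PN // andbT.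
by apply/eqP => sN; apply: ns; exists s.
Qed.

(** If no z - c lay in m, each would have an inverse modulo m, lying in the span of the words of
    some level k(c). By [maximal_ideal_dependent] a level serves only finitely many c, so K would be
    a countable union of finite sets. *)
Lemma nullstellensatz : finitely_generated A ->
  forall z, exists c : K, m (z - alg_const c).
Proof.
move=> [s sA] z; apply: contrapT => /forallNP zm.
have /choice[w wP] : forall c : K, exists w, m ((z - alg_const c) * w - 1).
  by move=> c; apply/(maximal_ideal_inv AC m_max)/zm.
have /choice[k kP] : forall c : K, exists k, in_span (words s k) (w c).
  by move=> c; apply: gen_in_span; rewrite sA.
have /choice[D DP] : forall j, exists D : seq K, forall c, k c = j -> c \in D.
  move=> j; apply: (@bounded_seq _ (size (words s j))) => r r_uniq rj.
  rewrite leqNgt; apply/negP => jr.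
  have [|c] := maximal_ideal_dependent (z := z) (w := w) r_uniq jr; last exact: zm.
  by move=> c cr; split=> //; rewrite -(rj _ cr).
by have [c /(_ (k c))] := K_uncountable D; rewrite DP.
Qed.

End Nullstellensatz.

(** * Matrix units and isomorphisms with matrix algebras *)

Lemma alg_isom_sym (K : comNzRingType) (A B : pzAlgType K) : alg_isom A B -> alg_isom B A.
Proof.
move=> [f fC [g fK gK]].
have gB : zmod_morphism g by move=> u v; rewrite -{1}[u]gK -{1}[v]gK -rmorphB fK.
have gM : GRing.monoid_morphism g.
  split=> [|u v]; first by rewrite -(rmorph1 f) fK.
  by rewrite -{1}[u]gK -{1}[v]gK -rmorphM fK.
pose g' : {rmorphism B -> A} := HB.pack_for {rmorphism B -> A} g
  (GRing.isZmodMorphism.Build _ _ g gB) (GRing.isMonoidMorphism.Build _ _ g gM).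
exists g'; first by move=> c; rewrite /g' /= -fC fK.
by exists f.
Qed.

Section MatrixUnits.
Variables (K : fieldType) (A : pzAlgType K).

Definition matrix_units (I : finType) (e : I -> I -> A) : Prop :=
  (forall i j k m, e i j * e k m = if j == k then e i m else 0) /\ \sum_i e i i = 1.

Definition mu_span (I : finType) (e : I -> I -> A) (u : A) : Prop :=
  exists c : I -> I -> K, u = \sum_i \sum_j c i j *: e i j.

Section Span.
Variables (I : finType) (e : I -> I -> A).

Lemma mu_spanD u v : mu_span e u -> mu_span e v -> mu_span e (u + v).
Proof.
move=> [c ->] [c' ->]; exists (fun i j => c i j + c' i j).
rewrite -big_split; apply: eq_bigr => i _; rewrite -big_split; apply: eq_bigr => j _.
by rewrite scalerDl.
Qed.

Lemma mu_spanZ c u : mu_span e u -> mu_span e (c *: u).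
Proof.
move=> [c' ->]; exists (fun i j => c * c' i j); rewrite scaler_sumr.
apply: eq_bigr => i _; rewrite scaler_sumr; apply: eq_bigr => j _.
by rewrite scalerA.
Qed.

Lemma mu_span0 : mu_span e 0.
Proof.
by exists (fun _ _ => 0); rewrite big1 // => i _; rewrite big1 // => j _; rewrite scale0r.
Qed.

Lemma mu_span_sum (J : finType) (F : J -> A) :
  (forall j, mu_span e (F j)) -> mu_span e (\sum_j F j).
Proof. by move=> eF; apply: big_ind => //; [exact: mu_span0|exact: mu_spanD]. Qed.

Lemma mu_span_unit i j : mu_span e (e i j).
Proof.
exists (fun i' j' => ((i' == i) && (j' == j))%:R).
rewrite (bigD1 i) //= (bigD1 j) //= !eqxx scale1r big1 ?addr0 => [|j' /negPf->].
  by rewrite big1 ?addr0 // => i' /negPf->; rewrite big1 // => j' _; rewrite scale0r.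
by rewrite andbF scale0r.
Qed.

Lemma mu_span_lmul u v : (forall i j, mu_span e (u * e i j)) -> mu_span e v ->
  mu_span e (u * v).
Proof.
move=> ue [c ->]; rewrite mulr_sumr; apply: mu_span_sum => i.
rewrite mulr_sumr; apply: mu_span_sum => j.
by rewrite -pzscalerAr; apply: mu_spanZ.
Qed.

End Span.

Hypothesis A_nontriv : (1 : A) <> 0.

(** The map goes from matrices to [A], where it has a formula, and is inverted afterwards.
    Independence of the matrix units is not assumed: it follows from their products and from 1 being
    nonzero. *)
Lemma matrix_units_isom (I : finType) (e : I -> I -> A) (N : nat) :
  matrix_units e -> #|I| = N -> (forall u, mu_span e u) -> alg_isom A 'M[K]_N.
Proof.
move=> [eM e1] <- espan; apply: alg_isom_sym.
pose f (M : 'M[K]_#|I|) : A := \sum_i \sum_j M (enum_rank i) (enum_rank j) *: e i j.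
have fB : zmod_morphism f.
  move=> M M'; rewrite -sumrB; apply: eq_bigr => i _; rewrite -sumrB.
  by apply: eq_bigr => j _; rewrite !mxE scalerBl.
have fC c : f c%:M = c *: (1 : A).
  rewrite -e1 scaler_sumr; apply: eq_bigr => i _; rewrite (bigD1 i) //= mxE eqxx.
  rewrite mulr1n big1 ?addr0 // => j ji.
  by rewrite mxE (inj_eq enum_rank_inj) eq_sym (negPf ji) scale0r.
have fM : GRing.monoid_morphism f.
  split; first by rewrite -[RHS]scale1r -fC.
  move=> M M'; rewrite [f M]/f mulr_suml; apply: eq_bigr => i _.
  rewrite mulr_suml.
  transitivity (\sum_j \sum_k (M (enum_rank i) (enum_rank k)
      * M' (enum_rank k) (enum_rank j)) *: e i j).
    apply: eq_bigr => j _; rewrite -scaler_suml; congr (_ *: _).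
    by rewrite -[M * M']/(M *m M') mxE (reindex enum_rank) //; apply/onW_bij/enum_rank_bij.
  rewrite exchange_big; apply: eq_bigr => k _.
  rewrite /f mulr_sumr [RHS](bigD1 k) //= [X in _ + X]big1 ?addr0 => [|k' kk'].
    rewrite mulr_sumr; apply: eq_bigr => j _.
    by rewrite -pzscalerAl -pzscalerAr eM eqxx scalerA.
  rewrite mulr_sumr big1 // => j _.
  by rewrite -pzscalerAl -pzscalerAr eM eq_sym (negPf kk') !scaler0.
pose f' : {rmorphism 'M[K]_#|I| -> A} := HB.pack_for {rmorphism 'M[K]_#|I| -> A} f
  (GRing.isZmodMorphism.Build _ _ f fB) (GRing.isMonoidMorphism.Build _ _ f fM).
exists f'; first by move=> c; rewrite [RHS]alg_constE; apply: fC.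
(* Recovers each entry of M from its image, which gives injectivity. *)
have entry M i j : \sum_k e k i * f M * e j k = M (enum_rank i) (enum_rank j) *: (1 : A).
  rewrite -e1 scaler_sumr; apply: eq_bigr => k _.
  rewrite /f mulr_sumr mulr_suml (bigD1 i) //= [X in _ + X]big1 ?addr0 => [|i' ii'].
    rewrite mulr_sumr mulr_suml (bigD1 j) //= big1 ?addr0 => [|j' jj'].
      by rewrite -pzscalerAr eM eqxx -pzscalerAl eM eqxx.
    by rewrite -pzscalerAr eM eqxx -pzscalerAl eM (negPf jj') scaler0.
  rewrite mulr_sumr mulr_suml big1 // => j' _.
  by rewrite -pzscalerAr eM eq_sym (negPf ii') scaler0 mul0r.
have f_inj : injective f.
  move=> M M' MM'; apply/matrixP => a b; rewrite -[a]enum_valK -[b]enum_valK.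
  apply/eqP/negPn/negP; rewrite -subr_eq0 => Mij; apply: A_nontriv.
  apply: (scalerI Mij); rewrite scaler0 scalerBl -!entry MM'.
  exact: subrr.
have /choice[g gf] : forall u, exists M, f M = u.
  move=> u; have [c ->] := espan u.
  exists (\matrix_(i, j) c (enum_val i) (enum_val j)).
  by apply: eq_bigr => i _; apply: eq_bigr => j _; rewrite mxE !enum_rankK.
by exists g => // M; apply: f_inj; rewrite gf.
Qed.

Lemma matrix_units_prod (I J : finType) (e : I -> I -> A) (e' : J -> J -> A) :
  (forall i j k m, GRing.comm (e i j) (e' k m)) ->
  matrix_units e -> matrix_units e' ->
  matrix_units (fun a b : I * J => e a.1 b.1 * e' a.2 b.2).
Proof.
move=> ee' [eM e1] [eM' e1']; split.
  move=> [i i'] [j j'] [k k'] [m m'] /=.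
  rewrite -mulrA [e' _ _ * _]mulrA -ee' -mulrA eM' mulrA eM xpair_eqE.
  by case: (j == k); case: (j' == k'); rewrite ?mulr0 ?mul0r.
transitivity (\sum_i \sum_j e i i * e' j j).
  by rewrite pair_bigA.
rewrite -[RHS]e1; apply: eq_bigr => i _.
by rewrite -mulr_sumr e1' mulr1.
Qed.

End MatrixUnits.

(** * Matrix units from one q-Weyl pair *)

Lemma sum_cyclic_shift (V : zmodType) (m : nat) (G : nat -> V) :
  G m = G 0 -> \sum_(k < m) G k.+1 = \sum_(k < m) G k.
Proof.
move=> Gm; apply: (addrI (G 0)); rewrite -[in RHS]Gm [RHS]addrC.
transitivity (\sum_(k < m.+1) G k); first by rewrite big_ord_recl.
by rewrite big_ord_recr.
Qed.

Section PairMatrixUnits.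
Variables (K : fieldType) (l : nat) (q : K).
Hypotheses (q_prim : l.-primitive_root q) (l_gt1 : (1 < l)%N).
Hypothesis K_roots : forall a : K, exists g, g ^+ l = a.
Variables (A : pzAlgType K) (x d : A) (alpha beta : K).
Hypothesis dxE : d * x = q *: (x * d) + 1.
Local Notation f := (d * x - x * d).
Hypotheses (f_unit : exists t, f * t = 1) (A_nontriv : (1 : A) <> 0).
Hypotheses (xl : x ^+ l = alpha *: (1 : A)) (dl : d ^+ l = beta *: (1 : A)).

(* The last condition makes x d invertible on every eigenspace of f but one, namely the one
   with eigenvalue g; this is what lets x and d generate the matrix units. *)
Lemma pair_fl_root : exists g : K, [/\ g != 0, f ^+ l = g ^+ l *: (1 : A)
  & forall s, (0 < s < l)%N -> g * q ^+ s != 1].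
Proof.
have l_gt0 := prim_order_gt0 q_prim.
have [c fl] := pair_fl q_prim dxE.
have {c fl} [gam fl] : exists gam : K, f ^+ l = gam *: (1 : A).
  exists (1 + c * (beta * alpha)).
  by rewrite fl xl dl -pzscalerAl mul1r !scalerA scalerDl scale1r mulrA.
have gam0 : gam != 0.
  apply/eqP => g0; apply: A_nontriv; apply: (pair_fnI f_unit (j := l)).
  by rewrite mul1r fl g0 scale0r.
have [g gl] := K_roots gam.
have g0 : g != 0 by apply: contraNneq gam0 => g0; rewrite -gl g0 expr0n gtn_eqF.
(* If g q^s = 1 for some excluded s, then gam = 1 and the root 1 can replace g, since q^s is not 1
   for 0 < s < l. *)
have [gs|gs] := pselect (forall s, (0 < s < l)%N -> g * q ^+ s != 1).
  by exists g; rewrite gl.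
exists 1; split; first exact: oner_neq0.
  move/existsNP: gs => [s /not_implyP[_ /negP/negPn/eqP gqs]].
  have : (g * q ^+ s) ^+ l = gam.
    by rewrite exprMn gl -exprM mulnC exprM (prim_expr_order q_prim) expr1n mulr1.
  by rewrite gqs fl => <-.
by move=> s /andP[s0 sl]; rewrite mul1r -(prim_order_dvd q_prim) gtnNdvd.
Qed.

(** Starting from the eigenspace of [f] with eigenvalue g, x climbs through the others and d
    descends, by the nonzero scalars [lam s]. The matrix units climb down with d, project, and climb
    up with x; x^l and d^l being scalars closes the cycle. *)
Lemma pair_matrix_units : exists e : 'I_l -> 'I_l -> A,
  [/\ matrix_units e, forall i j, mu_span e (x * e i j), forall i j, mu_span e (d * e i j)
    & forall i j u, GRing.comm u x -> GRing.comm u d -> GRing.comm u (e i j)].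
Proof.
have l_gt0 := prim_order_gt0 q_prim; have q0 := prim_neq0 q_prim.
have q1 := q1_neq0 q_prim l_gt1.
have l0 : l%:R != 0 :> K by exact: prim_root_natf_neq0 q_prim.
have [g [g0 fl gs]] := pair_fl_root.
(* Normalization making the eigenvalues l-th roots of unity: h^l = 1. *)
pose h := g^-1 *: f.
have hx : x * h = q^-1 *: (h * x).
  rewrite /h -pzscalerAl (pair_fx dxE) -pzscalerAr !scalerA; congr (_ *: _).
  by rewrite mulrAC mulVf // mul1r.
have hd : d * h = q *: (h * d).
  by rewrite /h -pzscalerAl -pzscalerAr (pair_df dxE) !scalerA [q * _]mulrC.
have fh : f = g *: h by rewrite /h scalerA mulfV // scale1r.
have hl : h ^+ l = 1 by rewrite /h pzexprZn fl scalerA -exprMn mulVf // expr1n scale1r.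
have hC u : GRing.comm u x -> GRing.comm u d -> GRing.comm u h.
  by move=> ux ud; apply/commrZ/pair_comm_f.
clearbody h.
have xhn k : x * h ^+ k = q^-1 ^+ k *: (h ^+ k * x).
  elim: k => [|k IHk]; first by rewrite mulr1 mul1r scale1r.
  by rewrite exprSr mulrA IHk -pzscalerAl -mulrA hx -pzscalerAr scalerA [q^-1 ^+ k.+1]exprSr mulrA.
have dhn k : d * h ^+ k = q ^+ k *: (h ^+ k * d).
  elim: k => [|k IHk]; first by rewrite mulr1 mul1r scale1r.
  by rewrite exprSr mulrA IHk -pzscalerAl -mulrA hd -pzscalerAr scalerA [q ^+ k.+1]exprSr mulrA.
(* A discrete Fourier transform: the projection onto the eigenspace of [h] for q^s. Division by l is
   possible since K contains a primitive l-th root of unity. *)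
pose E s := l%:R^-1 *: \sum_(k < l) q^-1 ^+ (s * k) *: h ^+ k.
have hE s : h * E s = q ^+ s *: E s.
  rewrite /E -pzscalerAr scalerA mulrC -scalerA; congr (_ *: _).
  rewrite mulr_sumr scaler_sumr.
  pose G k := q^-1 ^+ (s * k) *: h ^+ k.
  transitivity (\sum_(k < l) q ^+ s *: G k.+1).
    apply: eq_bigr => k _; rewrite -pzscalerAr -exprS scalerA mulnS exprD mulrA.
    by rewrite -exprMn mulfV // expr1n mul1r.
  rewrite -!scaler_sumr; congr (_ *: _).
  apply: sum_cyclic_shift.
  by rewrite /G muln0 hl mulnC exprM exprVn (prim_expr_order q_prim) invr1 expr1n.
have Eh s : E s * h = q ^+ s *: E s.
  rewrite -hE; apply/commr_sym/commrZ/commr_sum => k _.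
  by apply/commrZ/commrX.
have xE s : x * E s = E s.+1 * x.
  rewrite /E -pzscalerAr -pzscalerAl mulr_sumr mulr_suml; congr (_ *: _).
  apply: eq_bigr => k _; rewrite -pzscalerAr -pzscalerAl xhn scalerA.
  by rewrite -exprD mulSn addnC.
have dE : d * E 0%N = E l.-1 * d.
  rewrite /E -pzscalerAr -pzscalerAl mulr_sumr mulr_suml; congr (_ *: _).
  apply: eq_bigr => k _; rewrite -pzscalerAr -pzscalerAl dhn mul0n scale1r.
  by rewrite exprM -(prim_inv (prim_rootV q_prim)) invrK.
have E1 : \sum_(s < l) E s = 1.
  rewrite -scaler_sumr exchange_big /=.
  under eq_bigr do rewrite -scaler_suml (prim_root_sum (prim_rootV q_prim)).
  rewrite (bigD1 (Ordinal l_gt0)) //= dvdn0 big1 ?addr0 => [|k k0].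
    by rewrite scalerA mulVf // scale1r.
  by rewrite gtnNdvd ?scale0r // lt0n.
have E0E0 : E 0%N * E 0%N = E 0%N.
  rewrite {1}/E -pzscalerAl mulr_suml.
  under eq_bigr => k _.
    rewrite -pzscalerAl mul0n expr0 scale1r.
    have -> : h ^+ k * E 0%N = E 0%N.
      elim: (k : nat) => [|k' IHk']; first by rewrite mul1r.
      by rewrite exprSr -mulrA hE scale1r.
    over.
  by rewrite sumr_const card_ord -scaler_nat scalerA mulVf // scale1r.
have EC s u : GRing.comm u x -> GRing.comm u d -> GRing.comm u (E s).
  by move=> ux ud; apply/commrZ/commr_sum => k _; apply/commrZ/commrX/hC.
clearbody E.
(* On the range of [E s], f is g q^s, so x d = (q - 1)^-1 (f - 1) acts as [lam s]. The scalar
   [Lam s] is the effect of d^s x^s on [E 0]. *)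
pose lam s := (q - 1)^-1 * (g * q ^+ s - 1).
pose Lam s := \prod_(j < s) lam j.+1.
have lam0 s : (0 < s < l)%N -> lam s != 0.
  by move=> sl; rewrite mulf_neq0 ?invr_eq0 // subr_eq0 gs.
have Lam0 s : (s < l)%N -> Lam s != 0.
  move=> sl; apply/prodf_neq0 => j _; apply: lam0.
  by rewrite ltn0Sn (leq_ltn_trans _ sl).
have scaleB1 (c : K) (u : A) : (c *: u : A) - u = (c - 1) *: u by rewrite scalerBl scale1r.
have dxS s : d * (x ^+ s.+1 * E 0%N) = lam s.+1 *: (x ^+ s * E 0%N).
  apply: (q1I q_prim l_gt1); rewrite mulrA pzscalerAl (pair_dxS dxE) fh -mulrA.
  rewrite mulrBl mul1r -!pzscalerAl hE scale1r scalerA scalerA.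
  rewrite scaleB1 -pzscalerAr mulrA mulfV // mul1r.
  by rewrite [g * _]mulrC.
have dx0 s : d ^+ s * (x ^+ s * E 0%N) = Lam s *: E 0%N.
  elim: s => [|s IHs]; first by rewrite /Lam big_ord0 !mul1r scale1r.
  rewrite exprSr -mulrA dxS -pzscalerAr IHs scalerA /Lam big_ord_recr /=.
  by rewrite mulrC.
have xd0 s : x ^+ s * E 0%N * d ^+ s = Lam s *: E s.
  elim: s => [|s IHs]; first by rewrite /Lam big_ord0 mul1r mulr1 scale1r.
  rewrite exprS exprSr -!mulrA [E 0%N * (_ * _)]mulrA [x ^+ s * _]mulrA.
  rewrite [x ^+ s * _]mulrA IHs.
  rewrite -pzscalerAl -pzscalerAr mulrA xE -mulrA.
  have -> : x * d = (q - 1)^-1 *: (f - 1).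
    by rewrite -(pair_xd dxE) scalerA mulVf // scale1r.
  rewrite -pzscalerAr mulrBr mulr1 {1}fh -pzscalerAr Eh scalerA.
  rewrite [g *: _]scalerA scaleB1 !scalerA /Lam big_ord_recr /=.
  by rewrite mulrA.
(* Conjugation by [h] multiplies d^t x^s by q^(s - t), so for s != t its compression by [E 0]
   vanishes. *)
have hdx s t : q ^+ t *: (h * (d ^+ t * x ^+ s)) = q ^+ s *: (d ^+ t * x ^+ s * h).
  have dth : q ^+ t *: (h * d ^+ t) = d ^+ t * h.
    elim: t => [|t IHt]; first by rewrite mulr1 mul1r scale1r.
    rewrite [d ^+ t.+1]exprSr -[RHS]mulrA hd -pzscalerAr.
    by rewrite [d ^+ t * (h * d)]mulrA -IHt -pzscalerAl scalerA -mulrA [q ^+ t.+1]exprS.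
  have hxs : h * x ^+ s = q ^+ s *: (x ^+ s * h).
    elim: s => [|s IHs]; first by rewrite mulr1 mul1r scale1r.
    have hx' : h * x = q *: (x * h) by rewrite hx scalerA mulfV // scale1r.
    rewrite exprSr mulrA IHs -pzscalerAl -mulrA hx' -pzscalerAr scalerA.
    by rewrite [q ^+ s.+1]exprSr mulrA.
  by rewrite [h * _]mulrA pzscalerAl dth -mulrA hxs -pzscalerAr mulrA.
have EdxE s t : (s < l)%N -> (t < l)%N ->
    E 0%N * d ^+ t * (x ^+ s * E 0%N) = if t == s then Lam t *: E 0%N else 0.
  move=> sl tl; case: eqP => [->|/eqP ts].
    by rewrite -mulrA dx0 -pzscalerAr E0E0.
  have qts : q ^+ t - q ^+ s != 0.
    by rewrite subr_eq0 (eq_prim_root_expr q_prim) !modn_small.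
  apply: (scalerI qts); rewrite scaler0 scalerBl.
  have E0h : E 0%N * h = E 0%N by rewrite Eh scale1r.
  have hE0 : h * E 0%N = E 0%N by rewrite hE scale1r.
  have := congr1 (fun u => E 0%N * u * E 0%N) (hdx s t).
  rewrite -!pzscalerAr -!pzscalerAl !mulrA E0h -[X in _ = _ *: X]mulrA hE0 => ->.
  exact: subrr.
(* Carries x^t [E 0] to x^s [E 0]; the factor compensates the scalar of d^t x^t on [E 0]. *)
pose e (s t : 'I_l) := (Lam t)^-1 *: (x ^+ s * E 0%N * d ^+ t).
exists e; split.
- split=> [s t u v|].
    rewrite /e -pzscalerAl -pzscalerAr scalerA.
    have -> : x ^+ s * E 0%N * d ^+ t * (x ^+ u * E 0%N * d ^+ v)
        = x ^+ s * (E 0%N * d ^+ t * (x ^+ u * E 0%N)) * d ^+ v by rewrite !mulrA.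
    rewrite EdxE // -[t == u]/(val t == val u); case: eqP => _.
      rewrite -pzscalerAr -pzscalerAl scalerA mulrAC mulVf ?mul1r //; exact: Lam0.
    by rewrite mulr0 mul0r scaler0.
  rewrite -E1; apply: eq_bigr => s _.
  by rewrite /e xd0 scalerA mulVf ?scale1r //; apply: Lam0.
- move=> s t.
  have [sl|ls] := ltnP s.+1 l.
    have -> : x * e s t = e (Ordinal sl) t.
      by rewrite /e -pzscalerAr !mulrA -exprS.
    exact: mu_span_unit.
  have sl : s.+1 = l by apply/eqP; rewrite eqn_leq ls ltn_ord.
  have -> : x * e s t = alpha *: e (Ordinal l_gt0) t.
    rewrite /e -pzscalerAr !mulrA -exprS sl xl -!pzscalerAl !mul1r scalerA mulrC.
    by rewrite -scalerA.
  exact/mu_spanZ/mu_span_unit.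
- move=> [[|s] sl] t.
    have l1 : (l.-1 < l)%N by rewrite prednK.
    (* The cycle closes: d moves [E 0] to [E l.-1], which [xd0] expresses with a final d^(l-1), and
       the extra d turns it into d^l = beta. The coefficient may be zero. *)
    have -> : d * e (Ordinal sl) t = ((Lam l.-1)^-1 * beta) *: e (Ordinal l1) t.
      rewrite /e -pzscalerAr mul1r mulrA dE.
      have -> : E l.-1 = (Lam l.-1)^-1 *: (x ^+ l.-1 * E 0%N * d ^+ l.-1).
        by rewrite xd0 scalerA mulVf ?scale1r //; apply: Lam0.
      rewrite -!pzscalerAl -[_ * d ^+ l.-1 * d]mulrA -exprSr prednK // dl.
      by rewrite -pzscalerAr mulr1 -pzscalerAl !scalerA -mulrA [in LHS]mulrC.
    exact/mu_spanZ/mu_span_unit.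
  have -> : d * e (Ordinal sl) t = lam s.+1 *: e (Ordinal (ltnW sl)) t.
    by rewrite /e -pzscalerAr mulrA dxS -pzscalerAl !scalerA mulrC.
  exact/mu_spanZ/mu_span_unit.
- move=> s t u ux ud; apply/commrZ/commrM; last exact: commrX.
  by apply: commrM; [exact: commrX|exact: EC].
Qed.

End PairMatrixUnits.

(** * Matrix units from all pairs *)

Section FamilyMatrixUnits.
Variables (K : fieldType) (l n : nat) (q : K).
Hypotheses (q_prim : l.-primitive_root q) (l_gt1 : (1 < l)%N).
Hypothesis K_roots : forall a : K, exists g, g ^+ l = a.
Variables (A : pzAlgType K) (x d : 'I_n -> A) (t : A).
Hypothesis xd_family : qweyl_family q x d.
Local Notation F := (\prod_i family_f x d i).
Hypotheses (Ft : F * t = 1) (tF : t * F = 1) (A_nontriv : (1 : A) <> 0).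
Hypothesis gen_full :
  forall u, (gen_subalg ([set u | exists i, u = x i \/ u = d i] `|` [set t]) : set A) u.
Hypothesis xl_scalar : forall i, exists a : K, x i ^+ l = a *: (1 : A).
Hypothesis dl_scalar : forall i, exists a : K, d i ^+ l = a *: (1 : A).

Lemma mu_span_mul (I J : finType) (e : I -> I -> A) (e' : J -> J -> A) u v :
  mu_span e u -> mu_span e' v ->
  mu_span (fun a b : I * J => e a.1 b.1 * e' a.2 b.2) (u * v).
Proof.
move=> [c ->] [c' ->]; rewrite mulr_suml; apply: mu_span_sum => i.
rewrite mulr_suml; apply: mu_span_sum => j; rewrite mulr_sumr; apply: mu_span_sum => k.
rewrite mulr_sumr; apply: mu_span_sum => m; rewrite -pzscalerAl -pzscalerAr.
by apply/mu_spanZ/mu_spanZ; apply: (mu_span_unit _ (i, k) (j, m)).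
Qed.

(** Units built from the first k pairs commute with the later pairs, hence with the units of the
    next one, and products of commuting systems are again matrix units. *)
Lemma family_matrix_units k : (k <= n)%N -> exists (I : finType) (e : I -> I -> A),
  [/\ #|I| = (l ^ k)%N, matrix_units e,
      forall (i : 'I_n) a b, (k <= i)%N -> GRing.comm (e a b) (x i) /\ GRing.comm (e a b) (d i)
    & forall (i : 'I_n) a b, (i < k)%N -> mu_span e (x i * e a b) /\ mu_span e (d i * e a b)].
Proof.
elim: k => [_|k IHk kn].
  exists 'I_1, (fun _ _ => 1); split; rewrite ?card_ord //.
    by split=> [i j k m|]; rewrite ?big_ord1 // !ord1 eqxx mulr1.
  by move=> i a b _; split; apply/commr_sym/commr1.
have [I [e [cardI eM eC eS]]] := IHk (ltnW kn); pose i0 := Ordinal kn.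
have [a xa] := xl_scalar i0; have [b db] := dl_scalar i0.
have [e' [eM' xS' dS' eC']] := pair_matrix_units q_prim l_gt1 K_roots
  (family_dx xd_family i0) (family_f_unit xd_family Ft i0) A_nontriv xa db.
have ee' i j u v : GRing.comm (e i j) (e' u v).
  by have [ex ed] := eC i0 i j (leqnn k); apply: eC'.
exists (I * 'I_l)%type; eexists; split.
- by rewrite card_prod card_ord cardI expnSr.
- exact: matrix_units_prod ee' eM eM'.
- move=> i [u u'] [v v'] ki; have [ex ed] := eC i u v (ltnW ki).
  have ii0 : i != i0 by rewrite -val_eqE /= gtn_eqF.
  have i0i : i0 != i by rewrite eq_sym.
  split; apply/commr_sym/commrM => /=; try exact/commr_sym; apply: eC'.
  + exact: family_comm_xx xd_family _ _.
  + exact/commr_sym/(family_comm_dx xd_family).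
  + exact/(family_comm_dx xd_family).
  + exact: family_comm_dd xd_family _ _.
move=> i [u u'] [v v']; rewrite ltnS leq_eqVlt => /orP[/eqP ik|ik] /=.
  have -> : i = i0 by apply: val_inj.
  have [ex ed] := eC i0 u v (leqnn k).
  rewrite !mulrA -ex -ed -!mulrA; split; apply: mu_span_mul => //;
    exact: mu_span_unit.
have [xS dS] := eS i u v ik.
by rewrite !mulrA; split; apply: mu_span_mul => //; apply: mu_span_unit.
Qed.

(** [F ^+ l] is a nonzero scalar, so [t] is a multiple of [F ^+ l.-1] and the x_i and d_i alone
    generate. The span of the matrix units contains 1 and is stable under them, hence is
    everything. *)
Lemma family_isom : alg_isom A 'M[K]_(l ^ n).
Proof.
have [I [e [cardI eM _ eS]]] := family_matrix_units (leqnn n).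
apply: (matrix_units_isom A_nontriv eM cardI).
have [gam Fl] : exists gam : K, F ^+ l = gam *: (1 : A).
  move: (family_prod_fl_gen q_prim xd_family).
  elim/gen_subalg_ind: (F ^+ l) / => [u [][i _ <-]|c|u v [a ->] [b ->]|u v [a ->] [b ->]].
  - exact: xl_scalar.
  - exact: dl_scalar.
  - by exists c.
  - by exists (a + b); rewrite scalerDl.
  - by exists (a * b); rewrite -pzscalerAl mul1r scalerA.
have FtC : GRing.comm F t.
  by rewrite /GRing.comm Ft tF.
have gam0 : gam != 0.
  apply/eqP => g0; apply: A_nontriv.
  have : F ^+ l * t ^+ l = 1 by rewrite -exprMn_comm // Ft expr1n.
  by rewrite Fl g0 scale0r mul0r => /esym.
have l_gt0 := prim_order_gt0 q_prim.
have tE : t = gam^-1 *: F ^+ l.-1.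
  apply: (scalerI gam0); rewrite scalerA mulfV // scale1r.
  have <- : F ^+ l * t = F ^+ l.-1.
    by rewrite -[in LHS](prednK l_gt0) exprSr -mulrA Ft mulr1.
  by rewrite Fl -pzscalerAl mul1r.
have gen_xd u : (gen_subalg [set u | exists i, u = x i \/ u = d i] : set A) u.
  move: (gen_full u); apply: gen_subalg_sub => {u} u [Gu|->].
    exact (mem_gen_subalg Gu).
  rewrite tE; apply/subalgZ/subalg_memX/subalg_mem_prod => i.
  have Gx : (gen_subalg [set u | exists i, u = x i \/ u = d i] : set A) (x i).
    by apply: mem_gen_subalg; exists i; left.
  have Gd : (gen_subalg [set u | exists i, u = x i \/ u = d i] : set A) (d i).
    by apply: mem_gen_subalg; exists i; right.
  by apply: subalg_memB; apply: subalg_memM.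
move=> u; move: u (gen_xd u); apply: gen_subalg_lmul.
- exact: mu_spanD.
- exact: mu_spanZ.
- move=> u v [i ui] ev; apply: mu_span_lmul ev => a b.
  by have [] := eS i a b (ltn_ord i); case: ui => ->.
by case: eM => _ <-; apply: mu_span_sum => i; apply: mu_span_unit.
Qed.

End FamilyMatrixUnits.

(** * Freeness over the center and extension of its maximal ideals *)

Section Center.
Variables (K : fieldType) (A : pzAlgType K) (I : finType) (e : I -> A).
Hypothesis e_free : free_on setT (center A) e.
Local Notation Z := (subalg_type (center A)).

Lemma center_val (z : Z) a : val z * a = a * val z.
Proof. by have /subalg_predP := subalg_valP z; apply. Qed.

Lemma center_mulC (z w : Z) : z * w = w * z.
Proof. by apply: val_inj; rewrite /= (center_val z). Qed.

Lemma free_on_center r : #|I| = r -> free_over_center A r.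
Proof.
move=> <-; exists (fun i => e (enum_val i)) => a.
case: e_free => /(_ a Logic.I)[c cZ ac] indep _.
exists [ffun i => SubalgElt (asboolT (cZ (enum_val i)))]; split.
  rewrite ac (reindex (@enum_val I I)) /=; last exact/onW_bij/enum_val_bij.
  by apply: eq_bigr => i _; rewrite ffunE.
move=> c' ac'; apply/ffunP => i; apply: val_inj; rewrite ffunE /=; apply/esym.
apply/subr0_eq.
rewrite -[i in c' i](enum_valK i).
apply: (indep (fun j => val (c' (enum_rank j)) - c j)) => [j|].
  by apply: subalg_memB => //; apply/subalg_predP/subalg_valP.
under eq_bigr do rewrite mulrBl.
rewrite sumrB -ac ac' (reindex (@enum_val I I)) /=; last exact/onW_bij/enum_val_bij.
by apply/eqP; rewrite subr_eq0; apply/eqP/eq_bigr => j _; rewrite enum_valK.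
Qed.

(** The extended ideal lies in [J], the sum of the m e_i. As 1 need not be a basis vector, the
    contradiction comes from a basis vector e_i0 in [J]: its own coefficient 1 would have to lie in
    m. *)
Lemma maximal_gen_ideal_proper (m : set Z) : (0 < #|I|)%N -> maximal_ideal m ->
  ~ (gen_ideal (val @` m) : set A) 1.
Proof.
move=> /card_gt0P[i0 _] m_max m1; have [[m0 mD mMl mMr] _ _] := m_max.
pose J (a : A) := exists2 c : I -> Z, (forall i, m (c i)) & a = \sum_i val (c i) * e i.
case: e_free => span indep _.
have JD a b : J a -> J b -> J (a + b).
  move=> [c mc ->] [c' mc' ->]; exists (fun i => c i + c' i) => [i|]; first exact: mD.
  by rewrite -big_split; apply: eq_bigr => i _; rewrite mulrDl.
have J0 : J 0.
  by exists (fun=> 0) => //; rewrite big1 // => i _; rewrite mul0r.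
have Jm z a : m z -> J (val z * a).
  move=> mz; have [c cZ ->] := span a Logic.I.
  exists (fun i => z * SubalgElt (asboolT (cZ i))) => [i|]; first exact: mMr.
  by rewrite mulr_sumr; apply: eq_bigr => i _; rewrite /= mulrA.
have JI : twosided_ideal [set a | J a].
  split=> // a u [c mc ->]; rewrite /= ?mulr_sumr ?mulr_suml; apply: big_ind => // i _.
    by rewrite mulrA -center_val -mulrA; apply: Jm.
  by rewrite -mulrA; apply: Jm.
have J1 : J 1.
  apply: m1; split=> // _ [z mz <-]; rewrite /= -[val z]mulr1; exact: Jm.
have [c mc ec] : J (e i0).
  by case: JI => _ _ JMl _; rewrite -[e i0]mulr1; apply: JMl.
apply: (maximal_ideal_n1 m_max); suff -> : 1 = c i0 by [].
apply/val_inj/subr0_eq => /=.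
have := indep (fun i => (if i == i0 then 1 else 0) - val (c i)).
move=> /(_ _ _ i0); rewrite eqxx; apply=> [i|].
  apply: subalg_memB; last exact/subalg_predP/subalg_valP.
  by case: ifP => _; [apply: subalg_mem1|apply: subalg_mem0].
under eq_bigr do rewrite mulrBl.
rewrite sumrB -ec (bigD1 i0) //= eqxx mul1r big1 ?addr0 ?subrr // => i /negPf->.
by rewrite mul0r.
Qed.

End Center.

(** * Requirements on the base field *)

Lemma complex_uncountable (R : realType) (D : nat -> seq R[i]) :
  exists c : R[i], forall k, c \notin D k.
Proof.
apply: contrapT => /forallNP Dall.
have setT_countable : countable [set: R].
  (* If the lists exhausted [R[i]], their real parts would exhaust [R]. *)
  apply: (@sub_countable _ _ _ (\bigcup_k [set` [seq complex.Re z | z <- D k]])); last first.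
    by apply: bigcup_countable => // k _; apply/finite_set_countable/finite_seq.
  apply: subset_card_le => r _; have /existsNP[k /negP/negPn rk] := Dall r%:C%C.
  by exists k => //=; apply/mapP; exists r%:C%C.
(* The unit interval has measure 1, but measure 0 if it is countable. *)
have := lebesgue_measure_itv `[(0 : R), 1].
rewrite (countable_lebesgue_measure0 (sub_countable _ setT_countable)); last first.
  exact: subset_card_le.
by rewrite /= lte_fin Num.Theory.ltr01 oppr0 adde0 => /eqP; rewrite eq_sym eqe oner_eq0.
Qed.

(** Isolates what the Azumaya property asks of the field besides l-th roots, so that the algebra can
    be done over an abstract K. *)
Definition weak_nullstellensatz (K : fieldType) : Prop :=
  forall (Z : pzAlgType K), (forall u v : Z, u * v = v * u) -> finitely_generated Z ->
  forall m : set Z, maximal_ideal m -> forall z, exists c : K, m (z - alg_const c).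

(** * The Azumaya property of the localized algebra *)

Section LocalizedAzumaya.
Variables (K : fieldType) (l n : nat) (q : K).
Hypotheses (q_prim : l.-primitive_root q) (l_gt1 : (1 < l)%N).
Hypothesis K_roots : forall a : K, exists g, g ^+ l = a.
Hypothesis K_null : weak_nullstellensatz K.
Variables (A : pzAlgType K) (x d : 'I_n -> A) (t : A).
Hypothesis xd_family : qweyl_family q x d.
Local Notation F := (\prod_i family_f x d i).
Hypotheses (Ft : F * t = 1) (tF : t * F = 1).
Hypothesis gen_full :
  forall u, (gen_subalg ([set u | exists i, u = x i \/ u = d i] `|` [set t]) : set A) u.

Lemma localized_center u : (center A : set A) u <-> (tower l x d t n : set A) u.
Proof. by rewrite (centerE q_prim l_gt1 xd_family Ft tF gen_full). Qed.

Lemma localized_center_fg : finitely_generated (subalg_type (center A)).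
Proof.
have xlZ i : (center A : set A) (x i ^+ l) by apply/localized_center; exact: tower_xl.
have dlZ i : (center A : set A) (d i ^+ l) by apply/localized_center; exact: tower_dl.
have tlZ : (center A : set A) (t ^+ l) by apply/localized_center; exact: tower_tl.
pose zt := SubalgElt (asboolT tlZ).
pose zx i := SubalgElt (asboolT (xlZ i)).
pose zd i := SubalgElt (asboolT (dlZ i)).
pose s := zt :: map zx (enum 'I_n) ++ map zd (enum 'I_n).
exists s; apply/seteqP; split=> // z _.
(* Generation is known inside [A]; it is lifted to the subtype by exhibiting a preimage in the
   subalgebra generated by [s]. *)
suff Ps u : (tower l x d t n : set A) u -> exists2 w : subalg_type (center A),
    (gen_subalg [set` s] : set _) w & val w = u.
  have /subalg_predP/localized_center/Ps[w Gw wz] := subalg_valP z.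
  by rewrite (_ : z = w) //; apply: val_inj.
move: u; apply: gen_subalg_ind => [u|c|u v [w Gw <-] [w' Gw' <-]|u v [w Gw <-] [w' Gw' <-]].
- case=> [[[[i _ <-]|[i _ <-]]|->]|[i []]]; last by rewrite leqNgt ltn_ord.
  + exists (zx i) => //; apply: mem_gen_subalg; rewrite /= inE mem_cat.
    by rewrite (map_f zx) ?mem_enum ?orbT.
  + exists (zd i) => //; apply: mem_gen_subalg; rewrite /= inE mem_cat.
    by rewrite (map_f zd) ?mem_enum ?orbT.
  + by exists zt => //; apply: mem_gen_subalg; rewrite /= inE eqxx.
- exists (alg_const c); last by rewrite /= alg_constE.
  by rewrite alg_constE; apply/subalgZ/subalg_mem1.
- by exists (w + w') => //; apply: subalg_memD.
- by exists (w * w') => //; apply: subalg_memM.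
Qed.

Lemma localized_free : exists (I : finType) (e : I -> A),
  #|I| = ((l ^ n) ^ 2)%N /\ free_on setT (center A) e.
Proof.
have [I [e [cardI eF]]] := tower_basis q_prim l_gt1 xd_family Ft tF gen_full (leqnn n).
exists I, e; split; first by rewrite cardI mulnn -!expnM mulnC.
case: eF => span indep _; split=> // [u _|c cZ].
  have [c cT ->] := span u (tower0 q_prim Ft tF gen_full u).
  by exists c => // i; apply/localized_center; exact: cT.
by apply: indep => i; apply/localized_center; exact: cZ.
Qed.

Lemma localized_quotient (m : set (subalg_type (center A))) : maximal_ideal m ->
  alg_isom (quot_alg (gen_ideal (val @` m))) 'M[K]_(l ^ n).
Proof.
move=> m_max; have [I [e [cardI eF]]] := localized_free.
have I_gt0 : (0 < #|I|)%N by rewrite cardI !expn_gt0 (prim_order_gt0 q_prim).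
pose M := gen_ideal (val @` m); pose Q : pzAlgType K := quot_alg M.
pose pi : {rmorphism A -> Q} := quot_pi M.
have piC : alg_hom pi by [].
(* A central element differs from a scalar by an element of m, which the quotient kills. *)
have scalar u : (center A : set A) u -> exists a : K, pi u = a *: (1 : Q).
  move=> uZ; pose z := SubalgElt (asboolT uZ).
  have [c mc] := K_null (@center_mulC _ A) localized_center_fg m_max z.
  exists c; rewrite -alg_constE -piC; apply/quot_piP.
  by apply: sub_gen_smallest; exists (z - alg_const c).
pose X i := pi (x i); pose D i := pi (d i).
have pF : pi F = \prod_i family_f X D i by exact: rmorph_family_prod.
apply: (@family_isom K l n q q_prim l_gt1 K_roots Q X D (pi t)).
- exact: alg_hom_family.
- by rewrite -pF -rmorphM Ft rmorph1.
- by rewrite -pF -rmorphM tF rmorph1.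
- move=> Q1; apply: (maximal_gen_ideal_proper eF I_gt0 m_max).
  rewrite -[1]subr0; apply/quot_piP.
  exact (etrans (rmorph1 pi) (etrans Q1 (esym (rmorph0 pi)))).
- move=> u; rewrite -[u]quot_reprK; move: (quot_repr u) => {u} u.
  apply: (gen_subalg_sub _ (gen_subalg_image piC (gen_full u))).
  move=> _ [v [[i vi]| ->] <-]; apply: mem_gen_subalg; last by right.
  by left; exists i; case: vi => ->; [left|right].
- move=> i; rewrite /X -rmorphXn; apply: scalar; apply/localized_center; exact: tower_xl.
- move=> i; rewrite /D -rmorphXn; apply: scalar; apply/localized_center; exact: tower_dl.
Qed.

Lemma localized_azumaya : azumaya A.
Proof.
exists (l ^ n)%N; split; [|exact: localized_center_fg|exact: localized_quotient].
by have [I [e [cardI eF]]] := localized_free; exact (free_on_center eF cardI).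
Qed.

End LocalizedAzumaya.

(** * The complex case *)

Theorem lemma2p5 (R : realType) (n l : nat) (q : R[i])
    (hn : (1 <= n)%N) (hl : (1 < l)%N) (hq : l.-primitive_root q)
    (Af : pzAlgType R[i]) (phi : {rmorphism qweyl n q -> Af})
    (hAf : is_ore_localization (powers (weyl_f n q)) phi) :
  (forall (Zf : pzAlgType R[i]) (psi : {rmorphism subalg_type (weyl_Z n q l) -> Zf}),
     is_ore_localization
       [set z : subalg_type (weyl_Z n q l) | powers (weyl_f n q ^+ l) (val z)]
       psi ->
     alg_isom (subalg_type (center Af)) Zf)
  /\ azumaya Af.
Proof.
have xd_family := @weyl_family R[i] n q.
have xd_gen := @weyl_generated R[i] n q.
split; first exact (ore_center_isom hq hl xd_family xd_gen hAf).
have [t [Ft tF gen]] := ore_family_inv xd_gen hAf.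
have X_family := ore_family xd_family hAf.
apply: (localized_azumaya hq hl _ _ X_family Ft tF gen) => [a|Z ZC Zfg m m_max].
  (* An l-th root of a is a root of X^l - a, which is not constant. *)
  have /closed_rootP[g] : size ('X^l - a%:P) != 1%N.
    by rewrite size_XnsubC ?gtn_eqF // ltnW.
  by rewrite rootE !hornerE subr_eq0 => /eqP; exists g.
exact: (nullstellensatz (@complex_uncountable R) ZC m_max Zfg).
Qed.
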